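(* Let $x,y,z$ be nonnegative integers with $x\not\equiv z\pmod 2$, and let $\mathbf a=(a_1,\dots,a_m)$, $\mathbf b=(b_1,\dots,b_n)$, $\mathbf c=(c_1,\dots,c_k)$ be sequences of nonnegative integers with $m,n,k$ positive even integers. Put $g=\lfloor\frac{x+z}{2}\rfloor$, $g'=\lceil\frac{x+z}{2}\rceil$, $\mu=\max(a,b)$, $\nu=\min(a,b)$. Then \begin{align*} \operatorname{M}(R^{\leftarrow}_{x,y,z}(\mathbf a;\mathbf c;\mathbf b))=&\operatorname{M}(C_{x,2y+z+2\mu,z}(c))\\ &\times s\left(y+b-\nu,a_1,\dots,a_m,g,c_1,\dots,c_{k-1},c_k+g'+b_n,b_{n-1},\dots,b_1\right)\\ &\times s\left(a_1,\dots,a_{m-1},a_m+g+c_1,c_2,\dots,c_k,g',b_n,\dots,b_1,y+a-\nu\right)\\ &\times\frac{\operatorname{H}(c+g)}{\operatorname{H}(c)\operatorname{H}(g)}\frac{\operatorname{H}(\mu+y+g)}{\operatorname{H}(\mu+c+y+g)}\\ &\times \frac{\operatorname{H}(\mu+y+z)\operatorname{H}(\mu+c+y+z)}{\operatorname{H}(\mu-o_a+o_b+o_c+y+z)\operatorname{H}(\mu+o_a-o_b+e_c+y+z)}\\ &\times \frac{\operatorname{H}(\mu-o_a+o_b+o_c+y)\operatorname{H}(\mu+o_a-o_b+e_c+y)}{\operatorname{H}(\mu+y)^2}. \end{align*}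
   Context: Work on the triangular lattice drawn with horizontal lattice lines. A lozenge is the union of two unit triangles sharing an edge; a (lozenge) tiling of a region is a covering by lozenges without gaps or overlaps; $\operatorname{M}(R)$ denotes the number of tilings of $R$. Vertical distances are measured in rows (the height of a unit triangle); ''the horizontal lattice line at level $t$ above a point $P$'' is the horizontal lattice line $t$ rows above $P$. Lattice hexagons have all angles $120^\circ$ and their side-lengths are listed clockwise starting from the horizontal top side: north, northeast, southeast, south, southwest, northwest. The east vertex is the common vertex of the northeast and southeast sides; the west vertex is the common vertex of the southwest and northwest sides. Hyperfactorial: $\operatorname{H}(n)=0!\,1!\cdots(n-1)!$ for nonnegative integers $n$ ($\operatorname{H}(0)=1$). For a sequence $\mathbf t=(t_1,\dots,t_r)$ of nonnegative integers, $o_t=\sum_{i\text{ odd}}t_i$, $e_t=\sum_{i \text{ even}}t_i$, and $t=t_1+\dots+t_r$; so $a,b,c,o_a,e_a,o_b,\dots$ refer to $\mathbf a,\mathbf b,\mathbf c$. Dented semihexagon: $s(t_1,\dots,t_r)$ is the number of tilings of the region obtained from the trapezoid with horizontal top side of length $e_t$, horizontal bottom side of length $o_t+e_t$, and two slanted sides of length $o_t$, by removing from its bottom side up-pointing triangles of side-lengths $t_1,t_3,t_5,\dots$ from left to right, the first starting at the left end of the bottom side and consecutive removed triangles separated along the bottom side by distances $t_2,t_4,\dots$. (Equivalently, $s(t_1,\dots,t_{2l-1})=s(t_1,\dots,t_{2l})=\frac{1}{\operatorname{H}(t_1+t_3+\dots+t_{2l-1})}\frac{\prod_{1\le i<j\le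 2l-1,\ j-i\text{ odd}}\operatorname{H}(t_i+\dots+t_j)}{\prod_{1\le i<j\le 2l-1,\ j-i\text{ even}}\operatorname{H}(t_i+\dots+t_j)}$.) Cored hexagon: for nonnegative integers $X,Y,Z,p$, $C_{X,Y,Z}(p)$ is obtained from the hexagon $H$ with side-lengths $X,Y+p,Z,X+p,Y,Z+p$ as follows. Let $H_0$ be the hexagon with side-lengths $X,Y,Z,X,Y,Z$ whose south, southwest and northwest sides lie on the lines of the south, southwest and northwest sides of $H$; let $O$ be the center of symmetry of $H_0$. Remove the up-pointing triangle of side $p$ whose left vertex is: $O$ if $X,Y,Z$ all have the same parity; the point $1/2$ unit west of $O$ if $X$ has parity different from $Y$ and $Z$; the point $1/2$ unit from $O$ in the northwest lattice direction if $Y$ has parity different from $X$ and $Z$; the point $1/2$ unit from $O$ in the southwest lattice direction if $Z$ has parity different from $X$ and $Y$. Fern: a string of lattice triangles of side-lengths $t_1,\dots,t_r$ (side $0$ allowed) with alternating orientations, all having a horizontal side on a common horizontal lattice line $\ell$ (up-pointing ones above $\ell$, down-pointing ones below), consecutive triangles meeting at a vertex on $\ell$; it occupies a segment of $\ell$ of length $t_1+\dots+t_r$. Removing a fern means removing the union of its triangles. The region $R^{\leftarrow}_{x,y,z}(\mathbf a;\mathbf c;\mathbf b)$ (for $x\not\equiv z \pmod 2$): let $H$ be the hexagon with side-lengths $x+o_a+e_b+e_c$, $2y+z+e_a+o_b+o_c+|a-b|$, $z+o_a+e_b+e_c$, $x+e_a+o_b+o_c$, $2y+z+o_a+e_b+e_c+|a-b|$,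 $z+e_a+o_b+o_c$. Let $\ell$ be the horizontal lattice line at level $y$ above the east vertex of $H$ if $a\le b$, and at level $y+a-b$ if $a>b$; $\ell\cap H$ is a segment of length $x+z+a+b+c$. Remove from $H$ three ferns along $\ell$: the left fern with side-lengths $a_1,\dots,a_m$ from left to right, $a_1$ down-pointing, starting at the left endpoint of $\ell\cap H$; the right fern with side-lengths $b_1,\dots,b_n$ read from right to left, $b_1$ up-pointing, ending at the right endpoint of $\ell\cap H$; and the middle fern with side-lengths $c_1,\dots,c_k$ from left to right, $c_1$ up-pointing, placed so that the distance along $\ell$ from the right end of the left fern to the left end of the middle fern is $\lfloor\frac{x+z}{2}\rfloor$ and the distance from the right end of the middle fern to the left end of the right fern is $\lceil\frac{x+z}{2}\rceil$. *)

(* Defs.v *)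
From mathcomp Require Import all_boot.
From mathcomp Require Import finmap.

Set Implicit Arguments.
Unset Strict Implicit.
Unset Printing Implicit Defensive.

Local Open Scope fset_scope.
Local Open Scope nat_scope.

(* The lattice point (i, j) stands for i * e1 + j * e2, where e1 is the unit
   vector pointing east and e2 the unit vector at 60 degrees; j is thus the
   index of a horizontal lattice line, and the northwest lattice direction is
   e2 - e1.  All the regions below lie in the quadrant i, j >= 0. *)
Definition point : Type := (nat * nat)%type.

(* The cell (true, (i, j)) is the up-pointing unit triangle with left vertex
   (i, j); the cell (false, (i, j)) is the down-pointing unit triangle sharing
   the northeast edge of the former. *)
Definition cell : Type := (bool * (nat * nat))%type.

Definition vertices (u : cell) : seq point :=
  let: (up, (i, j)) := u in
  if up then [:: (i, j); (i.+1, j); (i, j.+1)]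
  else [:: (i.+1, j); (i.+1, j.+1); (i, j.+1)].

Definition share_edge (u v : cell) : bool :=
  count [in vertices v] (vertices u) == 2.

Definition lozenges (R : {fset cell}) : {fset {fset cell}} :=
  [fset L in fpowerset R |
    [exists u : R, exists v : R,
      share_edge (val u) (val v) && (L == [fset val u; val v])]].

Definition tilings (R : {fset cell}) : {fset {fset {fset cell}}} :=
  [fset T in fpowerset (lozenges R) |
    [forall u : R, #|` [fset L in T | val u \in L] | == 1]].

Definition M (R : {fset cell}) : nat := #|` tilings R|.

(* Hexagon with the given sides, placed with its west vertex at (0, sw).  Going
   around from there, its vertices are (0, sw), (0, sw + nw), (n, sw + nw),
   (sw + s, se), (sw + s, 0) and (sw, 0).  The polygon closes up if and only if
   n + nw = s + se and ne + se = nw + sw, so that n and ne are determined by the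
   other four sides.  Some sides may be 0. *)
Definition hexagon (n ne se s sw nw : nat) : {fset cell} :=
  [fset u in [seq (up, ij) | up <- [:: true; false],
                             ij <- [seq (i, j) | i <- iota 0 (sw + s),
                                                 j <- iota 0 (sw + nw)]] |
    all (fun P : point =>
           [&& sw <= P.1 + P.2 <= sw + s + se, P.1 <= sw + s
             & P.2 <= sw + nw])
        (vertices u)].

(* Lattice triangle of side t whose horizontal side has left end P; it lies above
   that side if up, and below it otherwise. *)
Definition in_triangle (up : bool) (P : point) (t : nat) (u : cell) : bool :=
  all (fun Q : point =>
         if up then [&& P.1 <= Q.1, P.2 <= Q.2 & Q.1 + Q.2 <= P.1 + P.2 + t]
         else [&& P.1 + P.2 <= Q.1 + Q.2, Q.1 <= P.1 + t & Q.2 <= P.2])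
      (vertices u).

(* Fern with left end P, its sides t being listed from left to right; up is the
   orientation of the leftmost triangle. *)
Fixpoint in_fern (up : bool) (P : point) (t : seq nat) (u : cell) : bool :=
  if t is t1 :: t' then
    in_triangle up P t1 u || in_fern (~~ up) (P.1 + t1, P.2) t' u
  else false.

(* Fern with right end P, its sides t being listed from right to left; up is the
   orientation of the rightmost triangle. *)
Fixpoint in_rfern (up : bool) (P : point) (t : seq nat) (u : cell) : bool :=
  if t is t1 :: t' then
    in_triangle up (P.1 - t1, P.2) t1 u
      || in_rfern (~~ up) (P.1 - t1, P.2) t' u
  else false.

Definition hyperfact (n : nat) : nat := \prod_(i < n) i`!.

(* The terms of a sequence are numbered from 1, those of a seq from 0. *)
Definition osum (t : seq nat) : nat :=
  \sum_(i < size t | ~~ odd i) nth 0 t i.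
Definition esum (t : seq nat) : nat :=
  \sum_(i < size t | odd i) nth 0 t i.

Fixpoint in_dents (P : point) (t : seq nat) (u : cell) : bool :=
  match t with
  | [::] => false
  | [:: t1] => in_triangle true P t1 u
  | [:: t1, t2 & t'] =>
      in_triangle true P t1 u || in_dents (P.1 + t1 + t2, P.2) t' u
  end.

(* A trapezoid is a hexagon whose southeast and southwest sides are 0. *)
Definition dented_semihexagon (t : seq nat) : {fset cell} :=
  let o := osum t in let e := esum t in
  [fset u in hexagon e o 0 (o + e) 0 o | ~~ in_dents (0, 0) t u].

Definition semihex (t : seq nat) : nat := M (dented_semihexagon t).

(* The hexagon H_0 with sides X, Y, Z, X, Y, Z shares the west vertex (0, Y) of
   H, and its east vertex is (X + Y, Z); its center is thus
   ((X + Y) / 2, (Y + Z) / 2).  All the halves below are exact. *)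
Definition core_vertex (X Y Z : nat) : point :=
  if (odd X == odd Y) && (odd Y == odd Z) then ((X + Y)./2, (Y + Z)./2)
  else if odd Y == odd Z then ((X + Y - 1)./2, (Y + Z)./2)
  else if odd X == odd Z then ((X + Y - 1)./2, (Y + Z + 1)./2)
  else ((X + Y)./2, (Y + Z - 1)./2).

Definition cored_hexagon (X Y Z p : nat) : {fset cell} :=
  [fset u in hexagon X (Y + p) Z (X + p) Y (Z + p) |
    ~~ in_triangle true (core_vertex X Y Z) p u].

(* In row q, the hexagon extends from the horizontal coordinate sw - q (0 if
   q >= sw) to the smaller of sw + s and sw + s + se - q. *)
Definition Rleft (x y z : nat) (a c b : seq nat) : {fset cell} :=
  let sa := sumn a in let sb := sumn b in
  let d := maxn sa sb - minn sa sb in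
  let n := x + osum a + esum b + esum c in
  let ne := 2 * y + z + esum a + osum b + osum c + d in
  let se := z + osum a + esum b + esum c in
  let s := x + esum a + osum b + osum c in
  let sw := 2 * y + z + osum a + esum b + esum c + d in
  let nw := z + esum a + osum b + osum c in
  let q := se + (if sa <= sb then y else y + sa - sb) in
  let l := sw - q in
  let r := minn (sw + s) (sw + s + se - q) in
  [fset u in hexagon n ne se s sw nw |
    ~~ [|| in_fern false (l, q) a u,
           in_fern true (l + sa + (x + z)./2, q) c u
         | in_rfern true (r, q) b u]].

(* Main.v *)
(* A tiling of R is cut along the line of the ferns into a tiling of an upper and
   of a lower dented trapezoid, where the lozenges crossing the line sit at a set
   S of z positions inside the two gaps.  A trapezoid with dents at the positions
   P has Vandermonde(P) / H(|P|) tilings, and in the product of the two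
   Vandermonde products the factors involving S only see the union of the dents
   of both halves.  This union consists of three full intervals, whose position
   relative to the gaps depends on y + mu, g, g' and c only; hence the sum over S
   is the same for R and for the cored hexagon, and it cancels in their ratio. *)
From mathcomp Require Import all_boot all_order all_algebra.
From mathcomp Require Import perm finmap zify ring.
Require Import Defs.
Set Implicit Arguments.
Unset Strict Implicit.
Unset Printing Implicit Defensive.
Import GRing.Theory Num.Theory.
Local Open Scope fset_scope.
Local Open Scope nat_scope.

(** * Perfect matchings *)

Section PerfectMatchings.

Variable T : choiceType.
Implicit Types (e : rel T) (R A B D L : {fset T}) (N : {fset {fset T}}).

Definition edges e R : {fset {fset T}} :=
  [fset L in fpowerset R |
    [exists u : R, exists v : R,
      e (val u) (val v) && (L == [fset val u; val v])]].

Definition matchings e R : {fset {fset {fset T}}} :=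
  [fset N in fpowerset (edges e R) |
    [forall u : R, #|` [fset L in N | val u \in L]| == 1]].

Definition nmatchings e R : nat := #|` matchings e R|.

Lemma edgesP e R L :
  reflect (exists u v, [/\ u \in R, v \in R, e u v & L = [fset u; v]])
          (L \in edges e R).
Proof.
rewrite !inE /=; apply: (iffP andP) => [[_]|[u [v [uR vR uv ->]]]].
  case/existsP=> u /existsP[v /andP[uv /eqP->]].
  by exists (val u), (val v); split=> //; apply: valP.
split; first by rewrite fpowersetE fsubUset !fsub1set uR vR.
apply/existsP; exists [` uR]; apply/existsP; exists [` vR].
by rewrite /= uv eqxx.
Qed.

Lemma edges_sub e R L : L \in edges e R -> L `<=` R.
Proof. by rewrite !inE fpowersetE => /andP[]. Qed.

Lemma edges_neq0 e R L : L \in edges e R -> exists u, u \in L.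
Proof. by case/edgesP=> u [v [_ _ _ ->]]; exists u; rewrite fset21. Qed.

Lemma edges_fsetD e R D L :
  (L \in edges e (R `\` D)) = (L \in edges e R) && [disjoint L & D]%fset.
Proof.
apply/idP/andP => [LRD|[/edgesP[u [v [uR vR uv LE]]] LD]].
  have /fsubsetDP[_ LD] := edges_sub LRD; split=> //.
  have /edgesP[u [v [/fsetDP[uR _] /fsetDP[vR _] uv LE]]] := LRD.
  by apply/edgesP; exists u, v.
have inL w : w \in L -> w \notin D by apply/fdisjointP.
by apply/edgesP; exists u, v; rewrite !in_fsetD !inL // LE ?fset21 ?fset22.
Qed.

Lemma eq_in_edges e e' R : {in R &, e =2 e'} -> edges e R = edges e' R.
Proof.
move=> ee'; apply/fsetP=> L.
by apply/edgesP/edgesP => -[u [v [uR vR uv ->]]]; exists u, v; split;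
  rewrite // ?ee' // -ee'.
Qed.

Lemma matchingsP e R N :
  reflect [/\ {subset N <= edges e R},
              forall u, u \in R -> exists2 L, L \in N & u \in L
            & forall L L' u, L \in N -> L' \in N ->
                u \in L -> u \in L' -> L = L']
          (N \in matchings e R).
Proof.
rewrite !inE /=; apply: (iffP andP) => [[]|[NR cover disj]].
  rewrite fpowersetE => /fsubsetP NR /forallP unique.
  have uniqueP u : u \in R ->
      exists L, forall L', (L' \in N) && (u \in L') = (L' == L).
    move=> uR; have /cardfs1P[L /fsetP LE] := unique [` uR]; exists L => L'.
    by have := LE L'; rewrite !inE.
  split=> // [u /uniqueP[L LE]|L L' u LN L'N uL uL'].
    by have := LE L; rewrite eqxx => /andP[]; exists L.
  have [L0 L0E] := uniqueP u (fsubsetP (edges_sub (NR _ LN)) _ uL).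
  have := L0E L; rewrite LN uL => /esym/eqP->.
  by have := L0E L'; rewrite L'N uL' => /esym/eqP->.
split; first by rewrite fpowersetE; apply/fsubsetP.
apply/forallP=> u; have [L LN uL] := cover _ (valP u).
apply/cardfs1P; exists L; apply/fsetP=> L'; rewrite !inE /=.
by apply/andP/eqP => [[L'N uL']|-> //]; apply: (disj _ _ (val u)).
Qed.

Lemma nmatchings_fset0 e : nmatchings e fset0 = 1.
Proof.
rewrite /nmatchings (_ : matchings e fset0 = [fset fset0]) ?cardfs1 //.
apply/fsetP=> N; rewrite in_fset1; apply/matchingsP/eqP => [[NR _ _]|->].
  apply/fsetP=> L; rewrite inE; apply/negP=> /NR /[dup] /edges_sub.
  by rewrite fsubset0 => /eqP-> /edges_neq0[u]; rewrite inE.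
by split=> // u; rewrite inE.
Qed.

Lemma eq_in_nmatchings e e' R :
  {in R &, e =2 e'} -> nmatchings e R = nmatchings e' R.
Proof. by move=> ee'; rewrite /nmatchings /matchings (eq_in_edges ee'). Qed.

Lemma matchings_add_edge e R L N : L \in edges e R ->
  N \in matchings e (R `\` L) -> L |` N \in matchings e R.
Proof.
move=> LR /matchingsP[NR cover disj].
have NL L' u : L' \in N -> u \in L' -> u \notin L.
  by move/NR; rewrite edges_fsetD => /andP[_ /fdisjointP]; apply.
apply/matchingsP; split=> [L'|u uR|L1 L2 u].
- by rewrite in_fset1U => /orP[/eqP->//|/NR]; rewrite edges_fsetD => /andP[].
- have [uL|uL] := boolP (u \in L); first by exists L; rewrite ?fset1U1.
  have [|L' L'N uL'] := cover u; first by rewrite in_fsetD uL.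
  by exists L'; rewrite // in_fset1U L'N orbT.
rewrite !in_fset1U => /orP[/eqP->|L1N] /orP[/eqP->|L2N] // u1 u2.
- by rewrite (negPf (NL _ _ L2N u2)) in u1.
- by rewrite (negPf (NL _ _ L1N u1)) in u2.
exact: disj L1N L2N u1 u2.
Qed.

Lemma matchings_del_edge e R L N : L \in N ->
  N \in matchings e R -> N `\ L \in matchings e (R `\` L).
Proof.
move=> LN /matchingsP[NR cover disj]; apply/matchingsP.
split=> [L' /fsetD1P[L'L L'N]|u /fsetDP[uR uL]|L1 L2 u].
- rewrite edges_fsetD NR //=; apply/fdisjointP => u uL'.
  by apply: contra L'L => uL; apply/eqP; apply: disj uL' uL.
- have [L' L'N uL'] := cover u uR; exists L' => //; rewrite in_fsetD1 L'N andbT.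
  by apply: contraNneq uL => <-.
by move=> /fsetD1P[_ L1N] /fsetD1P[_ L2N]; apply: disj.
Qed.

Lemma card_matchings_edge e R L : L \in edges e R ->
  #|` [fset N in matchings e R | L \in N]| = nmatchings e (R `\` L).
Proof.
move=> LR; have notN N : N \in matchings e (R `\` L) -> L \notin N.
  case/matchingsP=> NR _ _; apply/negP=> /NR; rewrite edges_fsetD => /andP[_].
  by have [u uL] := edges_neq0 LR; move/fdisjointP/(_ u uL); rewrite uL.
transitivity #|` (fun N => L |` N) @` matchings e (R `\` L)|; last first.
  apply: card_in_imfset => N1 N2 /notN N1L /notN N2L.
  by move/(congr1 (fun N => N `\ L)); rewrite !fsetU1K.
congr #|` _|; apply/fsetP=> N; rewrite in_fset [LHS]inE.
apply/andP/imfsetP => /= [[NR LN]|[N' N'R ->]].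
  by exists (N `\ L); [apply: matchings_del_edge|rewrite fsetD1K].
by rewrite fset1U1; split=> //; apply: matchings_add_edge.
Qed.

Definition del_edge L e : rel T := [rel u v | e u v && ([fset u; v] != L)].

Lemma edges_del_edge L e R : edges (del_edge L e) R = edges e R `\ L.
Proof.
apply/fsetP=> L'; rewrite in_fsetD1; apply/edgesP/andP.
  move=> [u [v [uR vR /andP[uv neqL] ->]]]; split=> //.
  by apply/edgesP; exists u, v.
move=> [neqL /edgesP[u [v [uR vR uv L'E]]]]; exists u, v.
by split=> //; rewrite /del_edge /= uv -L'E.
Qed.

Lemma nmatchings_deletion_contraction L e R : L \in edges e R ->
  nmatchings e R = nmatchings (del_edge L e) R + nmatchings e (R `\` L).
Proof.
move=> LR; rewrite -card_matchings_edge // addnC /nmatchings.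
have -> : matchings (del_edge L e) R = [fset N in matchings e R | L \notin N].
  apply/fsetP=> N; rewrite [RHS]in_fset [RHS]inE; apply/matchingsP/andP.
    move=> [NR cover disj]; split.
      apply/matchingsP; split=> // L' /NR.
      by rewrite edges_del_edge => /fsetD1P[].
    by apply/negP=> /NR; rewrite edges_del_edge in_fsetD1 eqxx.
  move=> [/matchingsP[NR cover disj] LN]; split=> // L' L'N.
  by rewrite edges_del_edge in_fsetD1 NR // andbT; apply: contraNneq LN => <-.
by rewrite !card_fset_sum1 (big_fsetID _ (fun N => L \in N)).
Qed.

Lemma nmatchings_expand e R u : symmetric e -> u \in R ->
  nmatchings e R = \sum_(v <- R | e u v) nmatchings e (R `\` [fset u; v]).
Proof.
move=> e_sym uR.
transitivity (\sum_(v <- R | e u v)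
                \sum_(N <- matchings e R | [fset u; v] \in N) 1).
  rewrite /nmatchings card_fset_sum1; under [RHS]eq_bigr do rewrite big_mkcond.
  rewrite exchange_big; apply: eq_big_seq => N /matchingsP[NR cover disj] /=.
  have [L LN uL] := cover _ uR.
  have [v [vR uv LE]] : exists v, [/\ v \in R, e u v & L = [fset u; v]].
    have /edgesP[u' [v' [u'R v'R u'v' LE]]] := NR _ LN.
    move: uL; rewrite LE !inE => /orP[/eqP->|/eqP->]; first by exists v'.
    by exists u'; rewrite e_sym fsetUC.
  rewrite big_mkcond (big_fsetD1 v vR) /= uv -LE LN big1_seq ?addn0 //= => w.
  rewrite in_fsetD1 => /andP[wv wR]; case: ifP => // uw; case: ifP => // wN.
  have wL : [fset u; w] = [fset u; v] by rewrite -LE (disj _ _ u wN LN) ?fset21.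
  have : (w \in [fset u; v]) && (v \in [fset u; w]).
    by rewrite -wL fset22 wL fset22.
  rewrite !inE (negPf wv) orbF [v == w]eq_sym (negPf wv) orbF.
  by case/andP=> /eqP<- /eqP vw; rewrite vw eqxx in wv.
rewrite big_seq_cond [RHS]big_seq_cond; apply: eq_bigr => v /andP[vR uv].
rewrite -card_matchings_edge ?card_fset_sum1 -?big_fset_condE //.
by apply/edgesP; exists u, v.
Qed.

Lemma nmatchings_isolated e R u : symmetric e -> u \in R ->
  {in R, forall v, ~~ e u v} -> nmatchings e R = 0.
Proof.
move=> e_sym uR iso; rewrite (nmatchings_expand e_sym uR) big1_seq // => v.
by case/andP=> uv /iso; rewrite uv.
Qed.

Lemma nmatchings_forced e R u v : symmetric e -> u \in R -> v \in R -> e u v ->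
    {in R, forall w, e u w -> w = v} ->
  nmatchings e R = nmatchings e (R `\` [fset u; v]).
Proof.
move=> e_sym uR vR uv only; rewrite (nmatchings_expand e_sym uR).
rewrite big_mkcond (big_fsetD1 v vR) /= uv big1_seq ?addn0 //= => w.
rewrite in_fsetD1 => /andP[wv wR]; case: ifP => // /(only _ wR) wE.
by rewrite wE eqxx in wv.
Qed.

Lemma nmatchings_fsetU e A B : symmetric e -> [disjoint A & B]%fset ->
    {in A & B, forall u v, ~~ e u v} ->
  nmatchings e (A `|` B) = nmatchings e A * nmatchings e B.
Proof.
move=> e_sym; have [n] := ubnP #|` A|; elim: n A => // n IHn A.
rewrite ltnS => leAn AB noedge; have [->|[u uA]] := fset_0Vmem A.
  by rewrite fset0U nmatchings_fset0 mul1n.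
have uAB : u \in A `|` B by rewrite in_fsetU uA.
rewrite (nmatchings_expand e_sym uA) (nmatchings_expand e_sym uAB).
rewrite big_distrl /=.
have notB w : w \in A -> w \notin B by move: w; apply/fdisjointP.
apply: eq_fbig_cond => v.
  rewrite !inE /=; have [//|vA] := boolP (v \in A).
  have [vB|//] := boolP (v \in B).
  by rewrite (negPf (noedge _ _ uA vB)).
rewrite in_fsetU => /orP[vA|vB] uv; last first.
  by rewrite (negPf (noedge _ _ uA vB)) in uv.
have -> : (A `|` B) `\` [fset u; v] = (A `\` [fset u; v]) `|` B.
  apply/fsetP=> w; rewrite !inE.
  have [->|_] := eqVneq w u; first by rewrite (negPf (notB _ uA)).
  by have [->|_] := eqVneq w v; rewrite ?(negPf (notB _ vA)).
rewrite IHn //.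
- by rewrite (leq_trans _ leAn) // fproper_ltn_card // fproperE fsubsetDl;
    apply/fsubsetPn; exists u; rewrite // !inE eqxx.
- exact: fdisjointWl (fsubsetDl _ _) AB.
by move=> w w' /fsetDP[wA _]; apply: noedge.
Qed.

End PerfectMatchings.

Lemma nmatchings_imfset (T T' : choiceType) (e : rel T) (e' : rel T')
    (f : T -> T') (R : {fset T}) :
    symmetric e -> symmetric e' -> {in R &, injective f} ->
    {in R &, forall u v, e' (f u) (f v) = e u v} ->
  nmatchings e' (f @` R) = nmatchings e R.
Proof.
move=> e_sym e'_sym; have [n] := ubnP #|` R|; elim: n R => // n IHn R.
rewrite ltnS => leRn f_inj f_edge.
have [->|[u uR]] := fset_0Vmem R; first by rewrite imfset0 !nmatchings_fset0.
rewrite (nmatchings_expand e_sym uR).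
have fuR : f u \in f @` R by rewrite in_imfset.
rewrite (nmatchings_expand e'_sym fuR) big_mkcond big_imfset // -big_mkcond /=.
rewrite big_seq_cond [RHS]big_seq_cond; apply: eq_big => v.
  by have [vR|] := boolP (v \in R); rewrite //= f_edge.
move=> /andP[vR _].
have sub : {subset R `\` [fset u; v] <= R} by move=> w /fsetDP[].
rewrite -IHn.
- rewrite -imfset_fset2; congr nmatchings; apply/fsetP=> w; rewrite in_fsetD.
  apply/andP/imfsetP => /=.
    move=> [wuv /imfsetP[w' /= w'R wE]]; exists w' => //.
    by rewrite in_fsetD w'R andbT; apply: contra wuv => ?; rewrite wE in_imfset.
  move=> [w' /fsetDP[w'R w'uv] ->].
  split; last by rewrite in_imfset.
  apply: contra w'uv => /imfsetP[t /= tuv ft].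
  have tR : t \in R by move: tuv; rewrite !inE => /orP[/eqP->|/eqP->].
  by rewrite (f_inj _ _ w'R tR ft).
- by rewrite (leq_trans _ leRn) // fproper_ltn_card // fproperE fsubsetDl;
    apply/fsubsetPn; exists u; rewrite // !inE eqxx.
- by move=> w w' /sub wR /sub w'R; apply: f_inj.
by move=> w w' /sub wR /sub w'R; apply: f_edge.
Qed.

Fixpoint subseqs (T : Type) (s : seq T) : seq (seq T) :=
  if s is x :: s' then subseqs s' ++ map (cons x) (subseqs s') else [:: [::]].

Lemma mem_subseqs (T : eqType) (s t : seq T) : (t \in subseqs s) = subseq t s.
Proof.
elim: s t => [|x s IHs] [|y t] //=; rewrite mem_cat IHs ?sub0seq //.
case: (y =P x) => [->|ne].
  rewrite mem_map ?IHs; last by move=> ? ? [].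
  by apply/orb_idl/subseq_trans/subseq_cons.
by apply/orb_idr => /mapP[t' _ [/ne]].
Qed.

Section Cut.

Variables (T : choiceType) (I : eqType) (f f' : I -> T).
Hypotheses (f_inj : injective f) (f'_inj : injective f').
Implicit Types (e : rel T) (G S : seq I) (A B : {fset T}).

Definition cut_sum e G A B : nat :=
  \sum_(S <- subseqs G | all (fun i => (f i \in A) && (f' i \in B)) S)
    nmatchings e (A `\` [fset u in map f S])
    * nmatchings e (B `\` [fset u in map f' S]).

Lemma cut_sum_del_edge e G A B i :
    i \notin G -> f i \in A -> f' i \in B -> [disjoint A & B]%fset ->
  cut_sum (del_edge [fset f i; f' i] e) G A B = cut_sum e G A B.
Proof.
move=> iG fiA f'iB /fdisjointP AB.
have f'iA : f' i \notin A by apply: contraL f'iB => /AB.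
have del_eq (C : {fset T}) : ~~ ((f i \in C) && (f' i \in C)) ->
    {in C &, del_edge [fset f i; f' i] e =2 e}.
  move=> notC u v uC vC; rewrite /del_edge /= andb_idr // => _.
  apply: contra notC => /eqP LE.
  have inC w : w \in [fset f i; f' i] -> w \in C.
    by rewrite -LE !inE => /orP[/eqP->|/eqP->].
  by rewrite !inC ?fset21 ?fset22.
apply: eq_bigr => S _; congr (_ * _); apply/eq_in_nmatchings/del_eq.
  by rewrite !in_fsetD (negPf f'iA) !andbF.
by rewrite !in_fsetD (negPf (AB _ fiA)) !andbF.
Qed.

Lemma cut_sum_contract e G A B i : i \notin G -> f i \in A -> f' i \in B ->
  cut_sum e G (A `\ f i) (B `\ f' i) =
  \sum_(S <- subseqs G | all (fun i => (f i \in A) && (f' i \in B)) S)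
    nmatchings e (A `\` [fset u in f i :: map f S])
    * nmatchings e (B `\` [fset u in f' i :: map f' S]).
Proof.
move=> iG fiA f'iB; rewrite /cut_sum big_seq_cond [RHS]big_seq_cond.
apply: eq_big => S /=; last by rewrite !fset_cons !fsetDDl.
rewrite mem_subseqs; have [SG|//] := boolP (subseq S G).
apply: eq_in_all => j /(mem_subseq SG) jG.
have ji : j != i by apply: contraNneq iG => <-.
by rewrite !in_fsetD1 (inj_eq f_inj) (inj_eq f'_inj) ji.
Qed.

Definition edge_cut e G A B : Prop :=
  [/\ [disjoint A & B]%fset,
      {in A & B, forall a b, e a b -> exists2 i, i \in G & a = f i /\ b = f' i}
    & {in G, forall i, f i \in A -> f' i \in B -> e (f i) (f' i)}].

Lemma edge_cut_absent e i G A B :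
    ~~ ((f i \in A) && (f' i \in B)) ->
  edge_cut e (i :: G) A B -> edge_cut e G A B.
Proof.
move=> absent [AB cross edge].
split=> // [a b aA bB /(cross _ _ aA bB)[j]|j jG].
  rewrite inE => /orP[/eqP->|jG] [aE bE]; last by exists j.
  by rewrite -aE -bE aA bB in absent.
by apply: edge; rewrite inE jG orbT.
Qed.

Lemma edge_cut_del_edge e i G A B : i \notin G -> f' i \in B ->
  edge_cut e (i :: G) A B -> edge_cut (del_edge [fset f i; f' i] e) G A B.
Proof.
move=> iG f'iB [AB cross edge].
split=> // [a b aA bB /andP[ab neqL]|j jG fjA f'jB].
  have [j] := cross _ _ aA bB ab.
  rewrite inE => /orP[/eqP->|jG] [aE bE]; last by exists j.
  by rewrite aE bE eqxx in neqL.
rewrite /del_edge /= edge ?inE ?jG ?orbT //=.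
apply: contraNneq iG => /fsetP/(_ (f j)); rewrite fset21 !inE (inj_eq f_inj).
case/esym/orP=> [/eqP<- //|/eqP fjE].
by move/fdisjointP/(_ _ fjA): AB; rewrite fjE f'iB.
Qed.

Lemma edge_cut_fsetD1 e i G A B :
  edge_cut e (i :: G) A B -> edge_cut e G (A `\ f i) (B `\ f' i).
Proof.
move=> [AB cross edge]; split=> [|a b|j jG /fsetD1P[_ fjA] /fsetD1P[_ f'jB]].
- by apply: fdisjointWl (fsubsetDl _ _) _; apply: fdisjointWr (fsubsetDl _ _) _.
- move=> /fsetD1P[afi aA] /fsetD1P[_ bB] /(cross _ _ aA bB)[j].
  rewrite inE => /orP[/eqP->|jG] [aE bE]; last by exists j.
  by rewrite aE eqxx in afi.
by apply: edge; rewrite // inE jG orbT.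
Qed.

(* Deletion-contraction of the edges joining A to B, one at a time. *)
Lemma nmatchings_cut e G A B : symmetric e -> uniq G -> edge_cut e G A B ->
  nmatchings e (A `|` B) = cut_sum e G A B.
Proof.
elim: G e A B => [|i G IHG] e A B e_sym.
  move=> _ [AB cross _].
  rewrite /cut_sum /= big_cons big_nil /= addn0 !fset_nil !fsetD0.
  apply: nmatchings_fsetU => // a b aA bB.
  by apply/negP=> /(cross _ _ aA bB)[].
case/andP=> iG uG cut; rewrite /cut_sum /= big_cat big_map /=.
have [/andP[fiA f'iB]|absent] := boolP ((f i \in A) && (f' i \in B));
  last first.
  by rewrite [X in _ + X]big_pred0 ?addn0 ?IHG //; apply: edge_cut_absent cut.
have [AB cross edge] := cut; set L := [fset f i; f' i].
have LAB : L \in edges e (A `|` B).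
  apply/edgesP; exists (f i), (f' i); rewrite !in_fsetU fiA f'iB orbT.
  by split=> //; apply: edge; rewrite ?mem_head.
rewrite (nmatchings_deletion_contraction LAB); congr (_ + _).
  rewrite IHG ?cut_sum_del_edge //; last exact: edge_cut_del_edge.
  by move=> u v; rewrite /del_edge /= e_sym fsetUC.
rewrite /= -cut_sum_contract // -IHG //; last exact: edge_cut_fsetD1.
have f'iA : f' i \notin A by apply: contraL f'iB => /(fdisjointP AB).
have fiB : f i \notin B by apply: (fdisjointP AB).
congr nmatchings; rewrite fsetDUl -!fsetDDl; congr (_ `|` _).
  by apply/fsetDidPl; rewrite fdisjointX1 in_fsetD1 (negPf f'iA) andbF.
by congr (_ `\` _); apply/fsetDidPl; rewrite fdisjointX1.
Qed.

End Cut.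

(** * Lozenges and rows *)

Definition adjacent_up_down (i j i' j' : nat) : bool :=
  [|| (i == i') && (j == j'), (i == i'.+1) && (j == j')
    | (i == i') && (j == j'.+1)].

Lemma share_edgeE b i j b' i' j' :
  share_edge (b, (i, j)) (b', (i', j')) =
  if b then ~~ b' && adjacent_up_down i j i' j'
  else b' && adjacent_up_down i' j' i j.
Proof.
have compare m n :
  [\/ [/\ (m == n) = true, (m.+1 == n) = false & (m == n.+1) = false],
    [/\ (m == n) = false, (m.+1 == n) = true & (m == n.+1) = false],
    [/\ (m == n) = false, (m.+1 == n) = false & (m == n.+1) = true]
  | [/\ (m == n) = false, (m.+1 == n) = false & (m == n.+1) = false]].
  have [|] := eqVneq m n; first by constructor 1; split; lia.
  have [|] := eqVneq m.+1 n; first by constructor 2; split; lia.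
  by have [|] := eqVneq m n.+1; [constructor 3|constructor 4]; split; lia.
rewrite /share_edge /adjacent_up_down ![i' == _]eq_sym ![j' == _]eq_sym.
by case: (compare i i') => -[i0 i1 i2]; case: (compare j j') => -[j0 j1 j2];
  case: b; case: b'; rewrite /= !inE !xpair_eqE !eqSS i0 i1 i2 j0 j1 j2.
Qed.

Lemma share_edgeC : symmetric share_edge.
Proof.
by move=> [b [i j]] [b' [i' j']]; rewrite !share_edgeE; case: b; case: b'.
Qed.

Lemma M_nmatchings (R : {fset cell}) : M R = nmatchings share_edge R.
Proof. by []. Qed.

Lemma M_fset0 : M fset0 = 1.
Proof. exact: nmatchings_fset0. Qed.

Lemma M_expand (R : {fset cell}) (u : cell) : u \in R ->
  M R = \sum_(v <- R | share_edge u v) M (R `\` [fset u; v]).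
Proof. exact: nmatchings_expand share_edgeC. Qed.

Lemma M_isolated (R : {fset cell}) (u : cell) :
  u \in R -> {in R, forall v, ~~ share_edge u v} -> M R = 0.
Proof. exact: nmatchings_isolated share_edgeC. Qed.

Lemma M_forced (R : {fset cell}) (u v : cell) :
    u \in R -> v \in R -> share_edge u v ->
    {in R, forall w, share_edge u w -> w = v} ->
  M R = M (R `\` [fset u; v]).
Proof. exact: nmatchings_forced share_edgeC. Qed.

Local Opaque M.

Lemma M_expand_down (R : {fset cell}) (i j : nat) : (false, (i, j)) \in R ->
  let M_with v := if v \in R then M (R `\` [fset (false, (i, j)); v]) else 0 in
  M R = M_with (true, (i, j)) + M_with (true, (i.+1, j))
        + M_with (true, (i, j.+1)).
Proof.
move=> uR M_with; rewrite (M_expand uR).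
pose ups : seq cell :=
  [:: (true, (i, j)); (true, (i.+1, j)); (true, (i, j.+1))].
transitivity (\sum_(v <- ups) M_with v).
  rewrite -big_mkcond -!(big_filter _ (fun v => v \in R)) -big_filter.
  apply: perm_big; apply: uniq_perm.
  - exact: filter_uniq (fset_uniq _).
  - by rewrite filter_uniq //= !inE !xpair_eqE; lia.
  move=> [b [i' j']]; rewrite !mem_filter share_edgeE andbC; congr (_ && _).
  by rewrite !inE !xpair_eqE /adjacent_up_down; case: b => //=; lia.
by rewrite 2!big_cons big_seq1 addnA.
Qed.

Lemma in_filter_fset (R : {fset cell}) (P : pred cell) (u : cell) :
  (u \in [fset v in R | P v]) = (u \in R) && P u.
Proof. by rewrite in_fset inE. Qed.

Definition above (q : nat) (A : {fset cell}) : Prop :=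
  {in A, forall u : cell, q <= u.2.2}.

Definition below (q : nat) (A : {fset cell}) : Prop :=
  {in A, forall u : cell, u.2.2 < q}.

Definition row (j : nat) (us ds : seq nat) : {fset cell} :=
  [fset u in [seq (true, (i, j)) | i <- us] ++ [seq (false, (i, j)) | i <- ds]].

Lemma in_row j us ds (b : bool) (i j' : nat) :
  ((b, (i, j')) \in row j us ds) = (j' == j) && (i \in if b then us else ds).
Proof.
rewrite !inE /=; apply/orP/andP => [[]/mapP[k kP [-> -> ->]] //|[/eqP->]].
by case: b => iP; [left|right]; apply/mapP; exists i.
Qed.

Definition dented (j : nat) (P : seq nat) (A : {fset cell}) : {fset cell} :=
  [fset u in A | ~~ [&& u.1, u.2.2 == j & u.2.1 \in P]].

Lemma in_dented j P A (b : bool) (i j' : nat) :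
  ((b, (i, j')) \in dented j P A) =
  ((b, (i, j')) \in A) && ~~ [&& b, j' == j & i \in P].
Proof. exact: in_filter_fset. Qed.

Lemma dented_nil j A : dented j [::] A = A.
Proof. by apply/fsetP=> -[b [i j']]; rewrite in_dented in_nil !andbF andbT. Qed.

Lemma dented_cat j P P' A : dented j (P ++ P') A = dented j P' (dented j P A).
Proof.
apply/fsetP=> -[b [i j']]; rewrite !in_dented mem_cat -andbA -negb_or.
by case: b; case: (j' == j).
Qed.

Lemma eq_dented j P P' A : P =i P' -> dented j P A = dented j P' A.
Proof.
by move=> PP'; apply/fsetP=> -[b [i j']]; rewrite !in_dented PP'.
Qed.

Fixpoint choices (T : Type) (rs : seq (seq T)) : seq (seq T) :=
  if rs is r :: rs' then [seq x :: l | x <- r, l <- choices rs'] else [:: [::]].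

(* For p_0 < .. < p_n, the sequences s with p_i <= s_i < p_(i+1). *)
Definition interlacings (P : seq nat) : seq (seq nat) :=
  if P is p :: P' then choices (pairmap index_iota p P') else [::].

Lemma interlacings_bounds p P l :
    sorted ltn (p :: P) -> l \in interlacings (p :: P) ->
  [/\ size l = size P, sorted ltn l & all (fun s => p <= s < last p P) l].
Proof.
elim: P p l => [|p' P IHP] p l /=; first by rewrite inE => _ /eqP->.
case/andP=> pp' sP /allpairsP[[s l'] /= [sp l'P ->]].
have [szl sl /allP lP] := IHP p' l' sP l'P.
have p'P : p' <= last p' P.
  have := mem_last p' P; rewrite inE => /orP[/eqP-> //|].
  by move/(allP (order_path_min ltn_trans sP))/ltnW.
move: sp; rewrite mem_index_iota => /andP[ps sp'].
split; first by rewrite /= szl.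
  by rewrite /= (path_sortedE ltn_trans) sl andbT; apply/allP=> t /lP; lia.
by rewrite /= ps (leq_trans sp' p'P); apply/allP=> t /lP; lia.
Qed.

Definition interlacing_sum (j : nat) (P : seq nat) (A : {fset cell}) : nat :=
  \sum_(l <- interlacings P | all (fun s => (true, (s, j)) \in A) l)
    M (dented j l A).

Lemma interlacing_sum1 j p A : interlacing_sum j [:: p] A = M A.
Proof. by rewrite /interlacing_sum /= big_cons big_nil /= dented_nil addn0. Qed.

Lemma interlacing_sum_cons j a p P A : sorted ltn [:: a, p & P] ->
  interlacing_sum j [:: a, p & P] A =
  (if a.+1 == p then 0 else interlacing_sum j [:: a.+1, p & P] A)
  + (if (true, (a, j)) \in A
     then interlacing_sum j (p :: P) (dented j [:: a] A) else 0).
Proof.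
move=> /andP[/= ap sP]; rewrite addnC /interlacing_sum.
have -> : interlacings [:: a, p & P] =
    [seq a :: l | l <- interlacings (p :: P)]
    ++ (if a.+1 == p then [::] else interlacings [:: a.+1, p & P]).
  rewrite /= /index_iota -(subnSK ap) /=; congr (_ ++ _).
  by case: eqP => [<-|//]; rewrite subnn.
rewrite big_cat big_map; congr (_ + _); last first.
  by case: ifP => // _; rewrite big_nil.
rewrite /=; case: (boolP (_ \in A)) => aA; last by rewrite big_pred0.
rewrite big_seq_cond [RHS]big_seq_cond; apply: eq_big => l; last first.
  by rewrite -dented_cat.
case: (boolP (l \in _)) => // /(interlacings_bounds sP)[_ _ /allP lP].
apply: eq_in_all => s /lP /andP[ps _]; rewrite in_dented !inE eqxx /=.
by rewrite (_ : s == a = false) ?andbT //; lia.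
Qed.

Definition up_row (j a n : nat) (P : seq nat) : {fset cell} :=
  row j [seq i <- iota a n.+1 | i \notin P] (iota a n).

Definition down_row (j a n : nat) (P : seq nat) : {fset cell} :=
  row j [seq i <- iota a.+1 n | i \notin P] (iota a n).

Section RowTransfer.

Variable j : nat.
Implicit Types (a n : nat) (P : seq nat) (A : {fset cell}).

Lemma up_row_dented a n P : up_row j a n (a :: P) = down_row j a n P.
Proof.
rewrite /up_row /down_row /= mem_head; congr row; apply: eq_in_filter => i.
by rewrite mem_iota inE => /andP[/gtn_eqF-> _].
Qed.

Lemma M_up_row_last a P A : above j.+1 A -> a \notin P ->
  M (up_row j a 0 P `|` A) = 0.
Proof.
move=> Aj aP; apply: (@M_isolated _ (true, (a, j))).
  by rewrite in_fsetU in_row mem_filter mem_head aP eqxx.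
move=> [b [i j']]; rewrite in_fsetU in_row share_edgeE /adjacent_up_down.
case: b => //; rewrite in_nil andbF /= => /Aj /=; lia.
Qed.

Lemma M_up_row_undented a n P A : above j.+1 A -> a \notin P ->
  M (up_row j a n.+1 P `|` A) = M (up_row j a.+1 n P `|` A).
Proof.
move=> Aj aP; rewrite (@M_forced _ (true, (a, j)) (false, (a, j))).
- congr M; apply/fsetP=> -[b [i j']].
  rewrite !(in_fsetD, in_fsetU, in_fset1, in_row) !xpair_eqE.
  have := Aj (b, (i, j')); case: (_ \in A) => [/(_ isT) /= |_].
    by rewrite !orbT; lia.
  by case: b; rewrite ?mem_filter !mem_iota; case: (i =P a); lia.
- by rewrite in_fsetU in_row mem_filter mem_head aP eqxx.
- by rewrite in_fsetU in_row mem_head eqxx.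
- by rewrite share_edgeE /adjacent_up_down !eqxx.
move=> [b [i j']]; rewrite in_fsetU in_row share_edgeE /adjacent_up_down.
case: b => // /orP[|/Aj /=]; last by lia.
by rewrite mem_iota => ? ?; congr (_, (_, _)); lia.
Qed.

Lemma M_down_row0 a P A : M (down_row j a 0 P `|` A) = M A.
Proof.
congr M; apply/fsetP=> -[b [i j']].
by rewrite in_fsetU in_row; case: b; rewrite in_nil andbF.
Qed.

Lemma M_down_rowS a n P A : above j.+1 A ->
  M (down_row j a n.+1 P `|` A) =
  (if a.+1 \in P then 0 else M (down_row j a.+1 n P `|` A))
  + (if (true, (a, j.+1)) \in A
     then M (up_row j a.+1 n P `|` dented j.+1 [:: a] A) else 0).
Proof.
move=> Aj; have notA b i : (b, (i, j)) \in A = false.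
  by apply/negP=> /Aj; rewrite ltnn.
have dR : (false, (a, j)) \in down_row j a n.+1 P `|` A.
  by rewrite in_fsetU in_row mem_head eqxx.
rewrite (M_expand_down dR); set R := _ `|` A.
have -> : ((true, (a, j)) \in R) = false.
  by rewrite in_fsetU in_row notA mem_filter mem_iota ltnn !andbF.
have -> : ((true, (a.+1, j)) \in R) = (a.+1 \notin P).
  by rewrite in_fsetU in_row notA mem_filter mem_head eqxx andbT orbF.
have -> : ((true, (a, j.+1)) \in R) = ((true, (a, j.+1)) \in A).
  by rewrite in_fsetU in_row gtn_eqF.
rewrite if_neg; congr (_ + _); case: ifP => // aP; congr M;
  apply/fsetP=> -[b [i j']];
  rewrite !(in_fsetD, in_fsetU, in_fset1, in_row) !xpair_eqE;
  rewrite ?in_dented ?in_cons ?in_nil;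
  have := Aj (b, (i, j')); case: (_ \in A) => [/(_ isT) /=|_];
  by case: b; rewrite ?mem_filter ?mem_iota; lia.
Qed.

Definition up_row_transfer a n : Prop :=
  forall P A, above j.+1 A -> sorted ltn P ->
    all (fun p => a <= p <= a + n) P ->
  M (up_row j a n P `|` A) = interlacing_sum j.+1 P A.

Definition down_row_transfer a n : Prop :=
  forall P A, above j.+1 A -> path ltn a P ->
    all (fun p => p <= a + n) P ->
  M (down_row j a n P `|` A) = interlacing_sum j.+1 (a :: P) A.

Lemma down_row_transfer0 a : down_row_transfer a 0.
Proof.
move=> [|p P] A _ /=; first by rewrite M_down_row0 interlacing_sum1.
by case/andP=> ap _ /andP[]; lia.
Qed.

(* Between two consecutive dents the row has one more down-pointing than
   up-pointing cells, hence exactly one of them is matched with the next row. *)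
Lemma down_row_transferS a n :
    up_row_transfer a.+1 n -> down_row_transfer a.+1 n ->
  down_row_transfer a n.+1.
Proof.
move=> up down P A Aj aP inP; have /allP lt_aP := order_path_min ltn_trans aP.
rewrite M_down_rowS // up; first last.
- by apply/allP=> p pP; have := lt_aP _ pP; have := allP inP _ pP; lia.
- exact: path_sorted aP.
- by move=> [b [i j']]; rewrite in_dented => /andP[/Aj].
case: P aP inP {lt_aP} => [|p P] aP inP.
  by rewrite down // !interlacing_sum1 /interlacing_sum big_nil if_same addn0.
rewrite interlacing_sum_cons // inE; have [/= ap sP] := andP aP.
have -> : (a.+1 \in P) = false.
  by apply/negP=> /(allP (order_path_min ltn_trans sP)) /=; lia.
rewrite orbF; case: eqP => [//|/eqP neq]; rewrite down //.
  by apply/andP; split=> //=; lia.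
by apply: sub_all inP => q; lia.
Qed.

Lemma up_row_transfer0 a : up_row_transfer a 0.
Proof.
move=> [|p P] A Aj sP inP.
  by rewrite M_up_row_last // /interlacing_sum big_nil.
have pa : p = a by move: inP => /=; lia.
rewrite pa in sP inP *; rewrite up_row_dented down_row_transfer0 //.
by case/andP: inP => _; apply: sub_all => q; lia.
Qed.

Lemma up_row_transferS a n :
    up_row_transfer a.+1 n -> down_row_transfer a n.+1 ->
  up_row_transfer a n.+1.
Proof.
move=> up down [|p P] A Aj sP inP; first by rewrite M_up_row_undented // up.
have [/= ap inP'] := andP inP; case: (eqVneq p a) => [pa|neq].
  rewrite pa in sP *; rewrite up_row_dented down //.
  by apply: sub_all inP' => q; lia.
have lt_aP q : q \in p :: P -> a < q.
  by rewrite inE => /orP[/eqP->|/(allP (order_path_min ltn_trans sP))] /=; lia.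
rewrite M_up_row_undented ?up //; last by apply/negP=> /lt_aP; rewrite ltnn.
by apply/allP=> q /[dup] /lt_aP aq /(allP inP); lia.
Qed.

Lemma M_up_row a n : up_row_transfer a n.
Proof.
suff [] : up_row_transfer a n /\ down_row_transfer a n by [].
elim: n a => [|n IHn] a.
  by split; [apply: up_row_transfer0|apply: down_row_transfer0].
have [up down] := IHn a.+1; have downS := down_row_transferS up down.
by split; first exact: up_row_transferS up downS.
Qed.

End RowTransfer.

(** * Binomial and Vandermonde determinants *)

Section Determinants.
Local Open Scope ring_scope.

Lemma prod_sum_choices (R : comPzRingType) (T : Type) (x0 : T)
    (rs : seq (seq T)) (G : 'I_(size rs) -> T -> R) :
  \prod_(i < size rs) \sum_(x <- nth [::] rs i) G i x =
  \sum_(l <- choices rs) \prod_(i < size rs) G i (nth x0 l i).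
Proof.
elim: rs G => [|r rs IHrs] G; first by rewrite big_seq1 !big_ord0.
rewrite big_ord_recl IHrs big_distrlr big_allpairs_dep /=.
by apply: eq_bigr => x _; apply: eq_bigr => l _; rewrite big_ord_recl.
Qed.

Lemma det_sum_choices (R : comPzRingType) (T : Type) (x0 : T) (rs : seq (seq T))
    (F : T -> 'I_(size rs) -> R) :
  \det (\matrix_(i, j) \sum_(x <- nth [::] rs i) F x j) =
  \sum_(l <- choices rs) \det (\matrix_(i, j) F (nth x0 l i) j).
Proof.
rewrite /determinant exchange_big; apply: eq_bigr => sg _.
rewrite -big_distrr /=; congr (_ * _); under eq_bigr do rewrite mxE.
rewrite (prod_sum_choices x0 (fun i x => F x (sg i))).
by apply: eq_bigr => l _; apply: eq_bigr => i _; rewrite mxE.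
Qed.

Lemma det_col0_1 (R : comPzRingType) n (A : 'M[R]_n.+1) :
    (forall i, A i ord0 = 1) ->
  \det A = \det (\matrix_(i < n, j < n)
    (A (lift ord0 i) (lift ord0 j) - A (widen_ord (leqnSn n) i) (lift ord0 j))).
Proof.
move=> A1.
pose L : 'M[R]_n.+1 := \matrix_(i, k) ((i == k)%:R - (i == k.+1 :> nat)%:R).
have detL : \det L = 1.
  rewrite det_trig.
    by rewrite big1 // => i _; rewrite mxE eqxx ltn_eqF // subr0.
  apply/is_trig_mxP => i k ik; rewrite mxE (ltn_eqF (leq_trans ik (leqnSn k))).
  by rewrite -val_eqE /= (ltn_eqF ik) subrr.
have LA0 j : (L *m A) ord0 j = A ord0 j.
  rewrite mxE (bigD1 ord0) //= big1 ?addr0 => [|k k0].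
    by rewrite mxE eqxx subr0 mul1r.
  by rewrite mxE eq_sym (negPf k0) subrr mul0r.
have LAS (i : 'I_n) j : (L *m A) (lift ord0 i) j =
    A (lift ord0 i) j - A (widen_ord (leqnSn n) i) j.
  rewrite mxE; under eq_bigr do rewrite mxE mulrBl.
  rewrite sumrB; congr (_ - _).
    rewrite (bigD1 (lift ord0 i)) //= eqxx mul1r big1 ?addr0 // => k /negPf ki.
    by rewrite eq_sym ki mul0r.
  rewrite (bigD1 (widen_ord (leqnSn n) i)) //= /bump add1n eqxx mul1r.
  rewrite big1 ?addr0 // => k.
  by rewrite -val_eqE /= eqSS eq_sym => /negPf->; rewrite mul0r.
rewrite -[LHS]mul1r -{1}detL -det_mulmx (expand_det_col _ ord0) big_ord_recl.
rewrite big1 ?addr0 => [|i _]; last by rewrite LAS !A1 subrr mul0r.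
rewrite LA0 A1 mul1r /cofactor addn0 expr0 mul1r.
by congr (\det _); apply/matrixP=> i j; rewrite [LHS]mxE [LHS]mxE LAS [RHS]mxE.
Qed.

Definition binom_det (n : nat) (l : seq nat) : int :=
  \det (\matrix_(i < n, j < n) ('C(nth 0%N l i, j))%:R).

Lemma sum_binom (R : pzRingType) (a b j : nat) : (a <= b)%N ->
  \sum_(a <= s < b) ('C(s, j))%:R = ('C(b, j.+1))%:R - ('C(a, j.+1))%:R :> R.
Proof.
move=> ab; rewrite -(telescope_sumr (fun s => ('C(s, j.+1))%:R) ab).
by apply: eq_bigr => s _; rewrite binS natrD addrC addKr.
Qed.

Lemma binom_det_interlacings p P : sorted ltn (p :: P) ->
  binom_det (size P).+1 (p :: P) =
  \sum_(l <- interlacings (p :: P)) binom_det (size P) l.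
Proof.
move=> sP; rewrite /binom_det det_col0_1; last by move=> i; rewrite mxE bin0.
rewrite /interlacings; set rs := pairmap _ _ _.
have szrs : size rs = size P by rewrite size_pairmap.
rewrite -szrs.
rewrite -(det_sum_choices 0%N (fun x (j : 'I_(size rs)) => ('C(x, j))%:R)).
congr (\det _); apply/matrixP=> i j; have iP : (i < size P)%N by rewrite -szrs.
rewrite !mxE (nth_pairmap 0%N) // sum_binom //.
apply/ltnW/(sorted_ltn_nth ltn_trans 0%N sP i i.+1) => //.
by rewrite inE ltnS ltnW.
Qed.

Lemma det_monic_horner (R : comNzRingType) n (f : nat -> {poly R})
    (a : 'rV[R]_n) :
    (forall j, f j \is monic) -> (forall j, size (f j) = j.+1) ->
  \det (\matrix_(i < n, j < n) (f j).[a 0 i]) =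
  \prod_(i < n) \prod_(j < n | (i < j)%N) (a 0 j - a 0 i).
Proof.
move=> monic_f size_f; rewrite -det_Vandermonde.
pose C : 'M[R]_n := \matrix_(j, k) (f j)`_k.
have detC : \det C = 1.
  rewrite det_trig.
    rewrite big1 // => i _; rewrite mxE.
    by move/monicP: (monic_f i); rewrite lead_coefE size_f.
  by apply/is_trig_mxP=> i k ik; rewrite mxE nth_default ?size_f.
rewrite -[RHS]mul1r -{1}detC -det_mulmx -det_tr; congr (\det _).
apply/matrixP=> j i; rewrite !mxE (@horner_coef_wide _ n) ?size_f //.
by apply: eq_bigr => k _; rewrite !mxE.
Qed.

Lemma ffact_horner (R : comNzRingType) (p j : nat) :
  (p ^_ j)%:R = (\prod_(0 <= k < j) ('X - k%:R%:P)).[p%:R] :> R.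
Proof.
elim: j => [|j IHj]; first by rewrite big_geq // hornerC ffactn0.
rewrite ffactnSr big_nat_recr //= hornerM -IHj hornerXsubC.
have [jp|pj] := leqP j p; first by rewrite natrM natrB.
by rewrite ffact_small // !mul0r.
Qed.

Fixpoint vandermonde (l : seq nat) : nat :=
  (if l is p :: l' then (\prod_(t <- l') `|p - t|) * vandermonde l' else 1)%N.

Lemma natr_vandermonde (l : seq nat) : sorted ltn l ->
  (vandermonde l)%:R =
  \prod_(i < size l) \prod_(j < size l | (i < j)%N)
    ((nth 0%N l j)%:R - (nth 0%N l i)%:R) :> int.
Proof.
elim: l => [|p l IHl] sl; first by rewrite big_ord0.
move: sl; rewrite /= (path_sortedE ltn_trans) => /andP[/allP lp sl].
rewrite natrM IHl // big_ord_recl; congr (_ * _).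
  rewrite [in RHS]big_mkcond [in RHS]big_ord_recl /= mul1r natr_prod.
  rewrite (big_nth 0%N) big_mkord; apply: eq_bigr => i _.
  have pi : (p < nth 0 l i)%N by apply: lp; rewrite mem_nth.
  by rewrite distnC distnEl ?natrB // ltnW.
apply: eq_bigr => i _; rewrite big_mkcond.
by rewrite [in RHS]big_mkcond [in RHS]big_ord_recl /= mul1r.
Qed.

Lemma binom_det_vandermonde (l : seq nat) : sorted ltn l ->
  binom_det (size l) l * (hyperfact (size l))%:R = (vandermonde l)%:R.
Proof.
move=> sl; rewrite natr_vandermonde //; set n := size l.
pose a : 'rV[int]_n := \row_i (nth 0%N l i)%:R.
pose f j : {poly int} := \prod_(0 <= k < j) ('X - k%:R%:P).
have -> : (hyperfact n)%:R = \det (diag_mx (\row_(j < n) (j`!)%:R)) :> int.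
  by rewrite det_diag natr_prod; apply: eq_bigr => j _; rewrite mxE.
transitivity (\det (\matrix_(i < n, j < n) (f j).[a 0 i])).
  rewrite -det_mulmx; congr (\det _); apply/matrixP=> i j.
  by rewrite mul_mx_diag !mxE -natrM bin_ffact ffact_horner.
rewrite det_monic_horner; last first.
- by move=> j; rewrite size_prod_XsubC size_iota subn0.
- by move=> j; apply: monic_prod_XsubC.
by apply: eq_bigr => i _; apply: eq_bigr => j _; rewrite !mxE.
Qed.

End Determinants.

Lemma vandermonde_insert l1 p l2 :
  vandermonde (l1 ++ p :: l2) =
  (\prod_(t <- l1 ++ l2) `|p - t|) * vandermonde (l1 ++ l2).
Proof.
elim: l1 => //= s l1 ->; rewrite /= !(big_cat, big_cons) /= distnC.
by ring.
Qed.

Lemma perm_vandermonde l l' : perm_eq l l' -> vandermonde l = vandermonde l'.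
Proof.
elim: l l' => [|p l IHl] l'; first by rewrite perm_sym => /perm_nilP->.
move=> pl; have pl' : p \in l' by rewrite -(perm_mem pl) mem_head.
case/splitPr: pl' pl => l1 l2.
rewrite perm_sym -cat1s perm_catCA perm_cons perm_sym => pl.
by rewrite vandermonde_insert /= (perm_big _ pl) (IHl _ pl).
Qed.

Lemma vandermonde_cat l1 l2 :
  vandermonde (l1 ++ l2) =
  vandermonde l1 * vandermonde l2 * \prod_(s <- l1) \prod_(t <- l2) `|s - t|.
Proof.
elim: l1 => [|p l1 IHl] /=; first by rewrite big_nil muln1 mul1n.
by rewrite IHl !(big_cat, big_cons) /=; ring.
Qed.

Lemma vandermonde_shift d l : vandermonde (map (addn d) l) = vandermonde l.
Proof.
elim: l => //= p l ->; congr (_ * _); rewrite big_map.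
by apply: eq_bigr => t _; rewrite distnDl.
Qed.

Lemma hyperfactS n : hyperfact n.+1 = hyperfact n * n`!.
Proof. exact: big_ord_recr. Qed.

Lemma vandermonde_iota p n : vandermonde (iota p n) = hyperfact n.
Proof.
elim: n p => [|n IHn] p /=; first by rewrite /hyperfact big_ord0.
rewrite IHn hyperfactS mulnC; congr (_ * _); rewrite fact_prod big_add1 /=.
rewrite -[in LHS](addn0 p.+1) iotaDl big_map /index_iota subn0.
by apply: eq_bigr => i _; lia.
Qed.

Lemma prod_dist_iota p m k :
  (\prod_(s <- iota p m) `|s - (p + m + k)|) * k`! = (m + k)`!.
Proof.
elim: m p => [|m IHm] p; first by rewrite big_nil mul1n.
rewrite big_cons -mulnA [p + m.+1]addnS -addSn IHm.
by rewrite (_ : `|p - _| = (m + k).+1) -?factS //; lia.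
Qed.

Lemma vandermonde_two_intervals p m g n :
  vandermonde (iota p m ++ iota (p + m + g) n)
  * (hyperfact (m + g) * hyperfact (g + n)) =
  hyperfact m * hyperfact n * (hyperfact (m + g + n) * hyperfact g).
Proof.
rewrite vandermonde_cat !vandermonde_iota -!mulnA; congr (_ * (_ * _)).
elim: n => [|n IHn].
  by rewrite big1_seq => [|s _]; rewrite ?big_nil // mul1n !addn0.
have -> : iota (p + m + g) n.+1 = rcons (iota (p + m + g) n) (p + m + (g + n)).
  by rewrite -[n.+1]addn1 iotaD cats1 addnA.
under eq_bigr do rewrite big_rcons.
rewrite big_split /= !addnS !hyperfactS -[in (m + g + n)`!]addnA.
rewrite -(prod_dist_iota p m (g + n)) addnA [RHS]mulnAC -IHn.
by ring.
Qed.

(** * Dented trapezoids *)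

(* Up-pointing trapezoid with lower left vertex (i0, q), lower base w and height
   h; it is cut off at its apex if h > w. *)
Definition trapezoid (i0 q w h : nat) : {fset cell} :=
  [fset u in [seq (b, ij) | b <- [:: true; false],
                 ij <- [seq (i, j) | i <- iota i0 w, j <- iota q h]] |
    u.2.1 + u.2.2 + (if u.1 then 1 else 2) <= i0 + q + w].

Lemma in_trapezoid i0 q w h (b : bool) (i j : nat) :
  ((b, (i, j)) \in trapezoid i0 q w h) =
  [&& i0 <= i, q <= j < q + h & i + j + (if b then 1 else 2) <= i0 + q + w].
Proof.
rewrite in_fset inE; apply/andP/and3P.
  case=> /allpairsP[[b' ij] /= [_ /allpairsP[[i' j'] /=]]].
  move=> [i'P j'P ->] [_ -> ->].
  by move: i'P j'P; rewrite !mem_iota => /andP[? ?] ? ?; split.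
case=> i0i qj le; split=> //; apply/allpairsP; exists (b, (i, j)); split=> //=.
  by case: b {le}.
apply/allpairsP; exists (i, j); split=> //=; rewrite mem_iota //.
by move: le; case: b; lia.
Qed.

Lemma dented_trapezoidS i0 q n h P :
  dented q P (trapezoid i0 q n.+1 h.+1) =
  up_row q i0 n P `|` trapezoid i0 q.+1 n h.
Proof.
apply/fsetP=> -[b [i j]]; rewrite in_fsetU in_row in_dented !in_trapezoid.
by case: b; rewrite ?mem_filter mem_iota; case: (i \in P); lia.
Qed.

Lemma M_dented_trapezoid_sorted i0 q w h P :
    h <= w -> sorted ltn P ->
    all (fun p => (true, (p, q)) \in trapezoid i0 q w h) P ->
  ((M (dented q P (trapezoid i0 q w h)))%:R =
   if size P == h then binom_det h P else 0 :> int)%R.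
Proof.
elim: h q w P => [|h IHh] q w P.
  case: P => [|p P] _ _; last by rewrite /= in_trapezoid; lia.
  rewrite (_ : trapezoid i0 q w 0 = fset0) ?dented_nil ?M_fset0 => [_|].
    by rewrite /binom_det det_mx00.
  by apply/fsetP=> -[b [i j]]; rewrite in_trapezoid inE; lia.
case: w => // n hn sP /allP inP.
have in_range (p : nat) : p \in P -> i0 <= p <= i0 + n.
  by move/inP; rewrite in_trapezoid; lia.
rewrite dented_trapezoidS; set A := trapezoid _ _ _ _.
have Aq : above q.+1 A.
  by move=> [b [i j]]; rewrite in_trapezoid /=; lia.
rewrite M_up_row //; last by apply/allP.
rewrite /interlacing_sum; case: P sP {inP} in_range => [|p P] sP in_range.
  by rewrite big_nil.
have in_A l s : l \in interlacings (p :: P) -> size P = h -> s \in l ->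
    (true, (s, q.+1)) \in A.
  move=> /(interlacings_bounds sP)[szl _ /allP lP] Ph sl; rewrite in_trapezoid.
  have := lP _ sl; have := in_range p (mem_head _ _).
  have := in_range (last p P) (mem_last p P).
  have : 0 < h by rewrite -Ph -szl; case: (l) sl.
  by lia.
have M_term l : l \in interlacings (p :: P) ->
    all (fun s => (true, (s, q.+1)) \in A) l ->
  ((M (dented q.+1 l A))%:R =
   if size P == h then binom_det h l else 0 :> int)%R.
  by case/(interlacings_bounds sP)=> szl sl _ lA; rewrite IHh // szl.
rewrite natr_sum big_seq_cond.
under eq_bigr => l /andP[lP lA] do rewrite M_term //.
rewrite eqSS; case: eqP => [Ph|_]; last by rewrite big1.
rewrite -Ph binom_det_interlacings // [RHS]big_seq; apply: eq_bigl => l.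
case: (boolP (l \in _)) => //= lP; apply/allP=> s sl.
exact: in_A lP Ph sl.
Qed.

Lemma M_dented_trapezoid i0 q w h P :
    h <= w -> uniq P ->
    all (fun p => (true, (p, q)) \in trapezoid i0 q w h) P ->
  M (dented q P (trapezoid i0 q w h)) * hyperfact h =
  if size P == h then vandermonde P else 0.
Proof.
move=> hw uP inP; pose P' := sort leq P.
have PP' : perm_eq P P' by rewrite perm_sym perm_sort.
have sP' : sorted ltn P'.
  by rewrite ltn_sorted_uniq_leq sort_uniq uP sort_sorted //; apply: leq_total.
rewrite (eq_dented _ _ (perm_mem PP')).
apply/eqP; rewrite -(eqr_nat int) natrM.
rewrite M_dented_trapezoid_sorted //; last by rewrite -(perm_all _ PP').
rewrite (perm_vandermonde PP') (perm_size PP').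
by case: (size P' =P h) => [<-|_]; rewrite ?binom_det_vandermonde ?mul0r.
Qed.

(** * Triangles on a line *)

Lemma in_triangle_up p q t (b : bool) (i j : nat) :
  in_triangle true (p, q) t (b, (i, j)) =
  [&& p <= i, q <= j & i + j + (if b then 1 else 2) <= p + q + t].
Proof. by rewrite /in_triangle; case: b => /=; lia. Qed.

Lemma in_triangle_down p q t (b : bool) (i j : nat) :
  in_triangle false (p, q) t (b, (i, j)) =
  [&& p + q <= i + j + (if b then 0 else 1), i < p + t & j < q].
Proof. by rewrite /in_triangle; case: b => /=; lia. Qed.

Lemma M_dented_run p q t (R : {fset cell}) :
    (forall i, p <= i < p + t ->
       ((false, (i, q)) \in R) && ((true, (i, q.+1)) \in R)) ->
  M (dented q (iota p t.+1) R) =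
  M (dented q.+1 (iota p t)
       (dented q (iota p t.+1) R `\` row q [::] (iota p t))).
Proof.
move=> runR.
pose matched k := dented q.+1 (iota p k)
  (dented q (iota p t.+1) R `\` row q [::] (iota p k)).
have in_matched k b i j : ((b, (i, j)) \in matched k) =
    ((b, (i, j)) \in R) && (if b then ~~ ((j == q) && (p <= i < p + t.+1))
                                      && ~~ ((j == q.+1) && (p <= i < p + k))
                            else ~~ ((j == q) && (p <= i < p + k))).
  rewrite in_dented in_fsetD in_dented in_row.
  case: (_ \in R); last by rewrite !andbF.
  by case: b; rewrite ?in_nil !mem_iota; lia.
suff M_matched k : k <= t -> M (matched 0) = M (matched k).
  rewrite -[RHS](M_matched t) //; congr M; apply/fsetP=> -[b [i j]].
  by rewrite in_matched in_dented mem_iota; case: (_ \in R) => //; case: b; lia.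
elim: k => // k IHk kt; rewrite IHk ?(ltnW kt) //.
have in_run : p <= p + k < p + t by lia.
have /andP[dR uR] := runR _ in_run.
rewrite (@M_forced _ (false, (p + k, q)) (true, (p + k, q.+1))).
- congr M; apply/fsetP=> -[b [i j]].
  rewrite !(in_fsetD, in_fsetU, in_fset1, in_matched) !xpair_eqE.
  by case: (_ \in R); rewrite ?andbF //; case: b; lia.
- by rewrite in_matched dR; lia.
- by rewrite in_matched uR; lia.
- by rewrite share_edgeE /adjacent_up_down !eqxx !orbT.
move=> [b [i j]]; rewrite in_matched share_edgeE /adjacent_up_down.
by case: b => // /andP[_ ?] ?; congr (_, (_, _)); lia.
Qed.

(* Once the base of the triangle is removed, its down-pointing cells are forced,
   row by row, to be matched upwards. *)
Lemma M_triangle p q t (R : {fset cell}) :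
    (forall u, in_triangle true (p, q) t u -> u \in R) ->
  M [fset u in R | ~~ in_triangle true (p, q) t u] = M (dented q (iota p t) R).
Proof.
elim: t q R => [|t IHt] q R triR.
  congr M; apply/fsetP=> -[b [i j]].
  rewrite in_filter_fset in_triangle_up in_dented in_nil.
  by congr (_ && ~~ _); case: b; lia.
rewrite M_dented_run => [|i ip]; last by rewrite !triR // in_triangle_up; lia.
rewrite -IHt => [|[b [i j]]].
  congr M; apply/fsetP=> -[b [i j]].
  rewrite !in_filter_fset in_fsetD in_row in_dented !in_triangle_up.
  case: (_ \in R); rewrite ?andbF //.
  by case: b; rewrite ?in_nil !mem_iota; lia.
rewrite in_triangle_up => utri.
rewrite in_fsetD in_row in_dented triR ?in_triangle_up; move: utri;
  by case: b; rewrite ?in_nil ?mem_iota; lia.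
Qed.

(* A pair (p, t) stands for the up-pointing triangle of side t whose base, on
   the line at level q, has left end p. *)
Definition in_triangles (q : nat) (ts : seq (nat * nat)) (u : cell) : bool :=
  has (fun x => in_triangle true (x.1, q) x.2 u) ts.

Definition bases (ts : seq (nat * nat)) : seq nat :=
  flatten [seq iota x.1 x.2 | x <- ts].

Lemma bases_cons x ts : bases (x :: ts) = iota x.1 x.2 ++ bases ts.
Proof. by []. Qed.

Lemma bases_cat ts ts' : bases (ts ++ ts') = bases ts ++ bases ts'.
Proof. by rewrite /bases map_cat flatten_cat. Qed.

Lemma in_triangles_cat q ts ts' u :
  in_triangles q (ts ++ ts') u = in_triangles q ts u || in_triangles q ts' u.
Proof. exact: has_cat. Qed.

Lemma in_triangles_bases q ts (b : bool) (i j : nat) :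
  in_triangles q ts (b, (i, j)) -> i \in bases ts.
Proof.
case/hasP=> -[p t] pts /=; rewrite in_triangle_up => pi; apply/flattenP.
by exists (iota p t); [apply: (map_f _ pts)|rewrite mem_iota; case: b pi; lia].
Qed.

Lemma M_triangles q ts (R : {fset cell}) :
    uniq (bases ts) -> (forall u, in_triangles q ts u -> u \in R) ->
  M [fset u in R | ~~ in_triangles q ts u] = M (dented q (bases ts) R).
Proof.
elim: ts R => [|x ts IHts] R.
  by move=> _ _; rewrite dented_nil; congr M; apply/fsetP=> u;
    rewrite in_filter_fset andbT.
rewrite bases_cons cat_uniq => /and3P[_ /hasPn disj uts] tsR.
have xR u : in_triangle true (x.1, q) x.2 u -> u \in R.
  by move=> xu; apply: tsR; rewrite /= xu.
pose R' := [fset u in R | ~~ in_triangles q ts u].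
transitivity (M [fset u in R' | ~~ in_triangle true (x.1, q) x.2 u]).
  congr M; apply/fsetP=> u; rewrite !in_filter_fset negb_or -andbA.
  by congr andb; apply: andbC.
rewrite M_triangle; last first.
  move=> [b [i j]] xu; rewrite in_filter_fset xR //=.
  apply/negP=> /in_triangles_bases/disj/=.
  by rewrite mem_iota; move: xu; rewrite in_triangle_up; case: b; lia.
transitivity (M [fset u in dented q (iota x.1 x.2) R | ~~ in_triangles q ts u]).
  by congr M; apply/fsetP=> -[b [i j]];
    rewrite in_dented [RHS]in_filter_fset in_dented in_filter_fset andbAC.
rewrite IHts //; last first.
  move=> [b [i j]] tsu; rewrite in_dented tsR; last by apply/orP; right.
  by apply/and3P=> -[_ _]; apply/negP/disj/(in_triangles_bases tsu).
by rewrite -dented_cat.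
Qed.

Lemma triangles_sub_trapezoid i0 q w h ts u :
    all (fun p => i0 <= p < i0 + w) (bases ts) -> size (bases ts) <= h ->
  in_triangles q ts u -> u \in trapezoid i0 q w h.
Proof.
case: u => b [i j] /allP inw szh /hasP[[p t] pts /=].
rewrite in_triangle_up => pij.
have pt_bases : {subset iota p t <= bases ts}.
  by move=> k kp; apply/flattenP; exists (iota p t); rewrite // (map_f _ pts).
have th : t <= size (bases ts).
  by rewrite -(size_iota p t); apply: uniq_leq_size pt_bases; apply: iota_uniq.
have pt_inw k : p <= k < p + t -> i0 <= k < i0 + w.
  by rewrite -mem_iota => /pt_bases/inw.
rewrite in_trapezoid; have := pt_inw p; have := pt_inw (p + t).-1.
by case: b pij; lia.
Qed.

Definition toothed_trapezoid (i0 q w h : nat) (ts : seq (nat * nat)) :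
  {fset cell} :=
  [fset u in trapezoid i0 q w h | ~~ in_triangles q ts u].

Lemma in_toothed_trapezoid i0 q w h ts u :
  (u \in toothed_trapezoid i0 q w h ts) =
  (u \in trapezoid i0 q w h) && ~~ in_triangles q ts u.
Proof. exact: in_filter_fset. Qed.

Lemma in_triangles_base q ts i :
  in_triangles q ts (true, (i, q)) = (i \in bases ts).
Proof.
apply/idP/idP => [/in_triangles_bases //|/flattenP[_ /mapP[[p t] pts ->]]].
rewrite mem_iota => ip; apply/hasP; exists (p, t) => //.
by rewrite in_triangle_up; lia.
Qed.

Lemma up_in_toothed_trapezoid i0 q w h ts i :
  ((true, (i, q)) \in toothed_trapezoid i0 q w h ts) =
  [&& i0 <= i < i0 + w, 0 < h & i \notin bases ts].
Proof.
rewrite in_toothed_trapezoid in_triangles_base in_trapezoid [RHS]andbA.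
by congr (_ && _); lia.
Qed.

Lemma M_toothed_trapezoid i0 q w h ts S :
    h <= w -> uniq (bases ts) -> all (fun p => i0 <= p < i0 + w) (bases ts) ->
    size (bases ts) <= h -> uniq S ->
    all (fun s => (true, (s, q)) \in toothed_trapezoid i0 q w h ts) S ->
  M (dented q S (toothed_trapezoid i0 q w h ts)) * hyperfact h =
  if size (bases ts) + size S == h then vandermonde (bases ts ++ S) else 0.
Proof.
move=> hw uts inw szh uS inS.
have disj s : s \in S -> s \notin bases ts.
  by move/(allP inS); rewrite up_in_toothed_trapezoid => /and3P[].
rewrite -size_cat -(@M_dented_trapezoid i0 q w) //; first last.
- rewrite all_cat; apply/andP; split; apply/allP=> p.
    move=> pts; apply: triangles_sub_trapezoid inw szh _.
    by rewrite in_triangles_base.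
  by move/(allP inS); rewrite in_toothed_trapezoid => /andP[].
- by rewrite cat_uniq uts uS andbT; apply/hasPn.
congr (_ * _).
transitivity (M [fset u in dented q S (trapezoid i0 q w h)
                | ~~ in_triangles q ts u]).
  congr M; apply/fsetP=> -[b [i j]].
  rewrite in_dented in_toothed_trapezoid [RHS]in_filter_fset.
  by rewrite [in RHS]in_dented andbAC.
rewrite M_triangles // => [|[b [i j]] tsu].
  by rewrite -dented_cat; congr M; apply: eq_dented => s; rewrite !mem_cat orbC.
rewrite in_dented (triangles_sub_trapezoid inw szh tsu).
by apply/and3P=> -[_ _ /disj/negP[]]; apply: in_triangles_bases tsu.
Qed.

(** * Ferns *)

Fixpoint fern_ups (up : bool) (p : nat) (t : seq nat) : seq (nat * nat) :=
  if t is t1 :: t' then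
    (if up then [:: (p, t1)] else [::]) ++ fern_ups (~~ up) (p + t1) t'
  else [::].

Lemma fern_ups_cat up p s t :
  fern_ups up p (s ++ t) =
  fern_ups up p s ++ fern_ups (up (+) odd (size s)) (p + sumn s) t.
Proof.
elim: s up p => [|s1 s IHs] up p /=; first by rewrite addn0 addbF.
by rewrite IHs catA addnA addbN addNb.
Qed.

Lemma in_fern_above up p q t u : q <= u.2.2 ->
  in_fern up (p, q) t u = in_triangles q (fern_ups up p t) u.
Proof.
case: u => b [i j] /= qj; elim: t up p => //= t1 t IHt up p.
rewrite IHt in_triangles_cat; congr (_ || _).
case: up; first by rewrite /= orbF.
by rewrite in_triangle_down [j < q]ltnNge qj !andbF.
Qed.

Lemma in_dents_fern_ups p q t u :
  in_dents (p, q) t u = in_triangles q (fern_ups true p t) u.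
Proof.
have [n] := ubnP (size t); elim: n t p => // n IHn [|t1 [|t2 t]] p //=.
  by rewrite orbF.
by move=> nt; rewrite IHn //; lia.
Qed.

Lemma osum_cons t1 t : osum (t1 :: t) = t1 + esum t.
Proof.
rewrite /osum /esum big_mkcond big_ord_recl /=; congr (_ + _).
by rewrite [RHS]big_mkcond; apply: eq_bigr => i _; rewrite negbK.
Qed.

Lemma esum_cons t1 t : esum (t1 :: t) = osum t.
Proof.
rewrite /osum /esum big_mkcond big_ord_recl /= add0n.
by rewrite [RHS]big_mkcond.
Qed.

Lemma osum_nil : osum [::] = 0. Proof. by rewrite /osum big_ord0. Qed.
Lemma esum_nil : esum [::] = 0. Proof. by rewrite /esum big_ord0. Qed.

Lemma osumDesum t : osum t + esum t = sumn t.
Proof.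
elim: t => [|t1 t IHt]; first by rewrite osum_nil esum_nil.
by rewrite osum_cons esum_cons -addnA [esum t + _]addnC IHt.
Qed.

Lemma size_bases_fern_ups up p t :
  size (bases (fern_ups up p t)) = if up then osum t else esum t.
Proof.
elim: t up p => [|t1 t IHt] up p /=; first by rewrite osum_nil esum_nil if_same.
rewrite bases_cat size_cat IHt osum_cons esum_cons.
by case: up; rewrite /bases //= cats0 size_iota.
Qed.

Lemma bases_fern_ups_shift d up p t :
  bases (fern_ups up (d + p) t) = map (addn d) (bases (fern_ups up p t)).
Proof.
elim: t up p => //= t1 t IHt up p; rewrite !bases_cat map_cat -IHt addnA.
by case: up; rewrite /bases //= !cats0 iotaDl.
Qed.

Lemma perm_bases_fern_ups p t :
  perm_eq (bases (fern_ups true p t) ++ bases (fern_ups false p t))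
          (iota p (sumn t)).
Proof.
elim: t p => //= t1 t IHt p; rewrite bases_cons.
by rewrite iotaD -catA perm_cat2l perm_catC.
Qed.

Lemma mem_bases_fern_ups up p t i :
  i \in bases (fern_ups up p t) -> p <= i < p + sumn t.
Proof.
rewrite -mem_iota -(perm_mem (perm_bases_fern_ups p t)) mem_cat.
by case: up => ->; rewrite ?orbT.
Qed.

Lemma bases_fern_ups_uniq up p t : uniq (bases (fern_ups up p t)).
Proof.
have := iota_uniq p (sumn t); rewrite -(perm_uniq (perm_bases_fern_ups p t)).
by rewrite cat_uniq => /and3P[uniq_ups _ uniq_downs]; case: up.
Qed.

Lemma in_hexagon n ne se s sw nw (b : bool) (i j : nat) :
  ((b, (i, j)) \in hexagon n ne se s sw nw) =
  [&& sw <= i + j + (if b then 0 else 1),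
      i + j + (if b then 1 else 2) <= sw + s + se, i < sw + s & j < sw + nw].
Proof.
rewrite in_fset inE; apply/andP/and4P => [[_]|[lower upper i_bd j_bd]].
  by case: b => /=; move=> H; split; lia.
split; last by case: b lower upper => /=; lia.
apply/allpairsP; exists (b, (i, j)); split=> //=; first by case: b {lower upper}.
by apply/allpairsP; exists (i, j); split=> //=; rewrite mem_iota; lia.
Qed.

Lemma dented_semihexagonE t :
  dented_semihexagon t =
  toothed_trapezoid 0 0 (sumn t) (osum t) (fern_ups true 0 t).
Proof.
apply/fsetP=> -[b [i j]].
rewrite [LHS]in_filter_fset in_toothed_trapezoid in_dents_fern_ups.
by rewrite in_hexagon in_trapezoid osumDesum; congr (_ && _); case: b; lia.
Qed.

Lemma semihex_vandermonde p t :
  semihex t * hyperfact (size (bases (fern_ups true p t))) =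
  vandermonde (bases (fern_ups true p t)).
Proof.
rewrite -[p]addn0 bases_fern_ups_shift size_map vandermonde_shift.
rewrite /semihex dented_semihexagonE.
rewrite -[toothed_trapezoid _ _ _ _ _](dented_nil 0).
have sz := size_bases_fern_ups true 0 t.
rewrite sz M_toothed_trapezoid ?cats0 ?sz ?addn0 ?eqxx //.
- by rewrite -osumDesum leq_addr.
- exact: bases_fern_ups_uniq.
by apply/allP=> i /mem_bases_fern_ups.
Qed.

(** * Gluing two trapezoids along a line *)

(* Reflection in a horizontal line: it sends the lattice line at level 0 to the
   one at level q, fixing first coordinates, and everything above the former
   below the latter. *)
Definition flip_cell (q : nat) (u : cell) : cell :=
  (~~ u.1, (u.2.1 + u.2.2 + (if u.1 then 0 else 1), q.-1 - u.2.2)).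

Lemma in_fern_flip up p q t u : u.2.2 < q ->
  in_fern up (p, q) t (flip_cell q u) = in_triangles 0 (fern_ups (~~ up) p t) u.
Proof.
case: u => b [i k] /= kq; elim: t up p => //= t1 t IHt up p.
rewrite IHt in_triangles_cat; congr (_ || _).
case: up; rewrite /flip_cell /= ?orbF ?in_triangle_up ?in_triangle_down;
  by case: b {IHt} => /=; lia.
Qed.

Lemma flip_cell_inj q :
  {in [pred u : cell | u.2.2 < q] &, injective (flip_cell q)}.
Proof.
move=> [b [i k]] [b' [i' k']]; rewrite !inE /= => kq k'q [bb' ei ek].
have {}bb' : b = b' by case: b b' bb' {ei} => [] [].
by rewrite -bb' in ei *; congr (_, (_, _)); lia.
Qed.

Lemma M_flip q (B : {fset cell}) : below q B ->
  M (flip_cell q @` B) = M B.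
Proof.
move=> Bq; apply: nmatchings_imfset share_edgeC share_edgeC _ _.
  by move=> u v /Bq uq /Bq vq; apply: flip_cell_inj.
move=> [b [i k]] [b' [i' k']] /Bq /= kq /Bq /= k'q.
rewrite !share_edgeE /adjacent_up_down.
by case: b; case: b' => //=; lia.
Qed.

Lemma mem_flip_line q (B : {fset cell}) i : below q B ->
  (flip_cell q (true, (i, 0)) \in flip_cell q @` B) = ((true, (i, 0)) \in B).
Proof.
move=> Bq; apply/imfsetP/idP => [[u /= uB]|iB]; last by exists (true, (i, 0)).
have uq := Bq _ uB; move/flip_cell_inj=> -> //; rewrite inE /=; lia.
Qed.

Lemma share_edge_line q u v : q <= u.2.2 -> v.2.2 < q ->
    share_edge u (flip_cell q v) ->
  exists i, u = (true, (i, q)) /\ v = (true, (i, 0)).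
Proof.
case: u v => [b [i j]] [b' [i' k]] /= qj kq.
rewrite share_edgeE /adjacent_up_down.
case: b; case: b' => //= uv; try lia.
by exists i; split; congr (_, (_, _)); lia.
Qed.

Lemma dented_fsetD q S (A : {fset cell}) :
  A `\` [fset u in [seq (true, (s, q)) | s <- S]] = dented q S A.
Proof.
apply/fsetP=> -[b [i j]]; rewrite in_fsetD in_dented andbC; congr (_ && ~~ _).
rewrite in_fset; apply/mapP/and3P => [[s sS [-> -> ->]] //|[bT /eqP-> iS]].
by exists i; rewrite ?bT.
Qed.

Lemma flip_dented q S (B : {fset cell}) : below q B ->
  flip_cell q @` dented 0 S B =
  flip_cell q @` B `\` [fset u in [seq flip_cell q (true, (s, 0)) | s <- S]].
Proof.
move=> Bq; apply/fsetP=> w; rewrite -dented_fsetD [RHS]in_fsetD.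
apply/imfsetP/andP => /= [[v /fsetDP[vB vS] ->]|[wS /imfsetP[v /= vB wE]]].
  split; last by rewrite in_imfset.
  apply: contra vS; rewrite !in_fset => /mapP[s sS vE].
  apply/mapP; exists s => //.
  by apply: flip_cell_inj vE; rewrite inE /= ?Bq // (leq_ltn_trans _ (Bq _ vB)).
exists v => //; rewrite in_fsetD vB andbT; apply: contra wS.
rewrite !in_fset wE => /mapP[s sS ->].
exact: (map_f (fun s => flip_cell q (true, (s, 0)))).
Qed.

Lemma M_glue q (A B : {fset cell}) (G : seq nat) :
    above q A -> below q B -> uniq G ->
    (forall i, (true, (i, q)) \in A -> (true, (i, 0)) \in B -> i \in G) ->
  M (A `|` flip_cell q @` B) =
  \sum_(S <- subseqs G |
           all (fun s => ((true, (s, q)) \in A) && ((true, (s, 0)) \in B)) S)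
    M (dented q S A) * M (dented 0 S B).
Proof.
move=> Aq Bq uG AB_G; pose f i : cell := (true, (i, q)).
pose f' i := flip_cell q (true, (i, 0)).
have f_inj : injective f by move=> i i' [].
have f'_inj : injective f' by move=> i i' []; lia.
have AB : [disjoint A & flip_cell q @` B]%fset.
  apply/fdisjointP=> u /Aq qu; apply/negP=> /imfsetP[v /= /Bq vq uE].
  by move: qu; rewrite uE /=; lia.
have cut : edge_cut f f' share_edge G A (flip_cell q @` B).
  split=> //.
    move=> u w uA /imfsetP[v /= vB ->].
    move=> /(share_edge_line (Aq _ uA) (Bq _ vB))[i [uE vE]].
    by exists i; rewrite ?uE ?vE // AB_G -?uE -?vE.
  move=> i _ _; rewrite mem_flip_line // => /Bq /= q_gt0.
  by rewrite share_edgeE /adjacent_up_down /=; lia.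
rewrite M_nmatchings (nmatchings_cut f_inj f'_inj share_edgeC uG cut).
apply: eq_big => S; first by apply: eq_all => s; rewrite mem_flip_line.
move=> _; rewrite -!M_nmatchings [X in M X * _]dented_fsetD; congr (_ * _).
rewrite -flip_dented // M_flip // => -[b [i j]].
by rewrite in_dented => /andP[/Bq].
Qed.

(* The sum over the positions S of the z lozenges crossing the line, G being the
   list of the positions available and W that of the dents of both halves. *)
Definition gap_sum (z : nat) (G W : seq nat) : nat :=
  \sum_(S <- subseqs G | size S == z)
    vandermonde S ^ 2 * \prod_(u <- W) \prod_(s <- S) `|u - s|.

Lemma eq_gap_sum z G W W' : perm_eq W W' -> gap_sum z G W = gap_sum z G W'.
Proof.
by move=> WW'; apply: eq_bigr => S _; congr (_ * _); apply: perm_big.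
Qed.

Section GlueToothed.

Variables (i1 q w1 i2 w2 z : nat) (ts1 ts2 : seq (nat * nat)).

Let U := bases ts1.
Let D := bases ts2.
Let h1 := size U + z.
Let h2 := size D + z.
Let A := toothed_trapezoid i1 q w1 h1 ts1.
Let B := toothed_trapezoid i2 0 w2 h2 ts2.

Hypotheses (le_h1 : h1 <= w1) (le_h2 : h2 <= w2).
Hypotheses (uU : uniq U) (uD : uniq D).
Hypothesis U_range : all (fun p => i1 <= p < i1 + w1) U.
Hypothesis D_range : all (fun p => i2 <= p < i2 + w2) D.

Lemma M_dented_halves S : uniq S ->
    all (fun s => ((true, (s, q)) \in A) && ((true, (s, 0)) \in B)) S ->
  M (dented q S A) * M (dented 0 S B) * (hyperfact h1 * hyperfact h2) =
  if size S == z then vandermonde U * vandermonde D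
    * (vandermonde S ^ 2 * \prod_(u <- U ++ D) \prod_(s <- S) `|u - s|) else 0.
Proof.
rewrite all_predI => uS /andP[SA SB].
rewrite mulnACA !M_toothed_trapezoid ?leq_addr // !eqn_add2l; case: eqP => // _.
by rewrite !vandermonde_cat big_cat /=; ring.
Qed.

Lemma M_glue_toothed G : h2 <= q -> uniq G ->
    (forall i, (i \in G) =
       [&& i1 <= i < i1 + w1, i2 <= i < i2 + w2 & i \notin U ++ D]) ->
  M (A `|` flip_cell q @` B) * (hyperfact h1 * hyperfact h2) =
  vandermonde U * vandermonde D * gap_sum z G (U ++ D).
Proof.
move=> le_h2q uG GE.
have upAB i : ((true, (i, q)) \in A) && ((true, (i, 0)) \in B) =
    [&& i \in G, 0 < h1 & 0 < h2].
  rewrite GE mem_cat negb_or !up_in_toothed_trapezoid.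
  by case: (i \in U); case: (i \in D); lia.
rewrite (@M_glue _ _ _ G) //; first last.
- by move=> i iA iB; have := upAB i; rewrite iA iB => /esym/andP[].
- move=> [b0 [i j]]; rewrite in_toothed_trapezoid in_trapezoid.
  by case/andP=> /and3P[] /=; lia.
- move=> [b0 [i j]]; rewrite in_toothed_trapezoid in_trapezoid.
  by case/andP=> /and3P[] /=; lia.
rewrite big_distrl /= big_seq_cond.
under eq_bigr => S /andP[SG SAB].
  rewrite mem_subseqs in SG; rewrite M_dented_halves ?(subseq_uniq SG) //; over.
rewrite -big_mkcondr /gap_sum big_distrr big_seq_cond [RHS]big_seq_cond /=.
apply: eq_bigl => S; rewrite mem_subseqs.
have [SG|//] := boolP (subseq S G); have [Sz|] := eqVneq; last by rewrite andbF.
rewrite andbT; apply/allP=> s sS; rewrite upAB (mem_subseq SG) //.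
have : 0 < z by rewrite -Sz; case: (S) sS.
by rewrite /h1 /h2; lia.
Qed.

End GlueToothed.

(** * The regions of the theorem *)

Lemma osum_esum_rcons s t1 :
  osum (rcons s t1) = osum s + (if odd (size s) then 0 else t1) /\
  esum (rcons s t1) = esum s + (if odd (size s) then t1 else 0).
Proof.
elim: s => [|s1 s [IHo IHe]] /=.
  by rewrite osum_cons esum_cons osum_nil esum_nil addn0.
by rewrite !osum_cons !esum_cons IHo IHe addnA !if_neg.
Qed.

Lemma osum_esum_rev s :
  osum (rev s) = (if odd (size s) then osum s else esum s) /\
  esum (rev s) = (if odd (size s) then esum s else osum s).
Proof.
elim: s => [|s1 s [IHo IHe]]; first by rewrite /= osum_nil esum_nil.
rewrite rev_cons /= osum_cons esum_cons.
have [-> ->] := osum_esum_rcons (rev s) s1; rewrite IHo IHe size_rev.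
by case: (odd (size s)); rewrite ?addn0 // addnC.
Qed.

Lemma in_rfernE up r q b u : sumn b <= r ->
  in_rfern up (r, q) b u =
  in_fern (up (+) ~~ odd (size b)) (r - sumn b, q) (rev b) u.
Proof.
have in_fern_rcons up' p s s1 : in_fern up' (p, q) (rcons s s1) u =
      in_fern up' (p, q) s u
      || in_triangle (up' (+) odd (size s)) (p + sumn s, q) s1 u.
  elim: s up' p => [|s2 s IHs] up' p /=; first by rewrite orbF addn0 addbF.
  by rewrite IHs orbA addnA addbN addNb.
elim: b up r => //= b1 b IHb up r br.
rewrite IHb; last lia.
rewrite rev_cons in_fern_rcons size_rev sumn_rev orbC !subnDA.
rewrite [r - b1 - sumn b + _]subnK; last lia.
congr (in_fern _ _ _ _ || in_triangle _ _ _ _);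
  by case: up; case: (odd (size b)).
Qed.

Lemma eq_glue q (R A B : {fset cell}) :
    above q A -> below q B ->
    (forall u, q <= u.2.2 -> (u \in R) = (u \in A)) ->
    (forall u, u.2.2 < q -> (flip_cell q u \in R) = (u \in B)) ->
    (forall (b : bool) i j, j < q -> (b, (i, j)) \in R ->
       q <= i + j + (if b then 0 else 1)) ->
  R = A `|` flip_cell q @` B.
Proof.
move=> Aq Bq RA RB Rq; apply/fsetP=> u; rewrite in_fsetU.
case: (leqP q u.2.2) => [qu|uq].
  rewrite -RA // orb_idr // => /imfsetP[v /= /Bq vq uE].
  by move: qu; rewrite uE /=; lia.
have -> : (u \in A) = false by apply/negP=> /Aq; rewrite leqNgt uq.
apply/idP/imfsetP => [uR|[v /= vB ->]]; last by rewrite RB ?Bq.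
case: u uq uR => b [i j] /= jq uR; have le_q := Rq b i j jq uR.
pose v : cell := (~~ b, (i + j + (if b then 0 else 1) - q, q.-1 - j)).
have uE : (b, (i, j)) = flip_cell q v.
  rewrite /flip_cell /= negbK; congr (_, (_, _));
    by case: b {uR} le_q {v} => /=; lia.
by exists v; rewrite // -RB -?uE //=; lia.
Qed.

Definition upper_teeth (l g g' : nat) (a c b : seq nat) : seq (nat * nat) :=
  let e := l + sumn a + g in
  (0, l) :: fern_ups false l a ++ fern_ups true e c
    ++ fern_ups false (e + sumn c + g') (rev b).

Definition lower_teeth (l r g g' : nat) (a c b : seq nat) : seq (nat * nat) :=
  let e := l + sumn a + g in
  fern_ups true l a ++ fern_ups false e c
    ++ fern_ups true (e + sumn c + g') (rev b)
    ++ [:: (e + sumn c + g' + sumn b, r)].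

Definition core_intervals (Y g g' n : nat) : seq nat :=
  iota 0 Y ++ iota (Y + g) n ++ iota (Y + g + n + g') Y.

Definition core_gaps (Y g g' n : nat) : seq nat :=
  iota Y g ++ iota (Y + g + n) g'.

Lemma core_intervals_uniq Y g g' n : uniq (core_intervals Y g g' n).
Proof.
rewrite /core_intervals !cat_uniq !iota_uniq /= andbT.
by apply/andP; split; apply/hasPn=> i /=; rewrite ?mem_cat !mem_iota; lia.
Qed.

Lemma core_gaps_uniq Y g g' n : uniq (core_gaps Y g g' n).
Proof.
rewrite cat_uniq !iota_uniq andbT.
by apply/hasPn=> i /=; rewrite !mem_iota; lia.
Qed.

Lemma rcons_of_even (s : seq nat) : 0 < size s -> ~~ odd (size s) ->
  exists s' t1, s = rcons s' t1 /\ odd (size s').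
Proof.
case/lastP: s => // s t1 _; rewrite size_rcons /= negbK => os.
by exists s, t1.
Qed.

Section Teeth.

Variables (l r g g' : nat) (a c b : seq nat).

Lemma size_bases_upper_teeth : ~~ odd (size b) ->
  size (bases (upper_teeth l g g' a c b)) = l + esum a + osum c + osum b.
Proof.
move=> b_even; rewrite bases_cons !bases_cat !size_cat.
rewrite !size_bases_fern_ups size_iota.
by have [_ ->] := osum_esum_rev b; rewrite (negPf b_even) !addnA.
Qed.

Lemma size_bases_lower_teeth : ~~ odd (size b) ->
  size (bases (lower_teeth l r g g' a c b)) = osum a + esum c + esum b + r.
Proof.
move=> b_even; rewrite !bases_cat bases_cons cats0 !size_cat.
rewrite !size_bases_fern_ups size_iota.
by have [-> _] := osum_esum_rev b; rewrite (negPf b_even) !addnA.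
Qed.

Lemma mem_bases_upper_teeth p : p \in bases (upper_teeth l g g' a c b) ->
  p < l + sumn a + g + sumn c + g' + sumn b.
Proof.
rewrite /upper_teeth bases_cons !bases_cat !mem_cat mem_iota.
by case/or4P=> [|/mem_bases_fern_ups|/mem_bases_fern_ups|/mem_bases_fern_ups];
  rewrite ?sumn_rev /=; lia.
Qed.

Lemma mem_bases_lower_teeth p : p \in bases (lower_teeth l r g g' a c b) ->
  l <= p < l + sumn a + g + sumn c + g' + sumn b + r.
Proof.
rewrite /lower_teeth !bases_cat bases_cons cats0 !mem_cat mem_iota.
by case/or4P=> [/mem_bases_fern_ups|/mem_bases_fern_ups|/mem_bases_fern_ups|];
  rewrite ?sumn_rev /=; lia.
Qed.

Lemma perm_bases_teeth : l + sumn a = sumn b + r ->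
  perm_eq (bases (upper_teeth l g g' a c b)
             ++ bases (lower_teeth l r g g' a c b))
          (core_intervals (l + sumn a) g g' (sumn c)).
Proof.
move=> laE; rewrite /core_intervals (iotaD 0) add0n.
have -> e : iota e (l + sumn a) = iota e (sumn b) ++ iota (e + sumn b) r.
  by rewrite laE iotaD.
rewrite /upper_teeth /lower_teeth !(bases_cons, bases_cat) cats0.
apply/seq.permP=> P; rewrite !count_cat.
set e := l + sumn a + g; set e' := e + sumn c + g'.
have := seq.permP (perm_bases_fern_ups l a) P.
have := seq.permP (perm_bases_fern_ups e c) P.
have := seq.permP (perm_bases_fern_ups e' (rev b)) P.
by rewrite sumn_rev !count_cat /=; lia.
Qed.

Hypotheses (a_gt0 : 0 < size a) (a_even : ~~ odd (size a)).
Hypotheses (b_gt0 : 0 < size b) (b_even : ~~ odd (size b)).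
Hypotheses (c_gt0 : 0 < size c) (c_even : ~~ odd (size c)).

Lemma fern_ups_upper :
  fern_ups true 0 (l :: a ++ g :: take (size c).-1 c
    ++ (last 0 c + g' + last 0 b) :: rev (take (size b).-1 b)) =
  upper_teeth l g g' a c b.
Proof.
have [c' [ck [-> oc]]] := rcons_of_even c_gt0 c_even.
have [b' [bn [-> ob]]] := rcons_of_even b_gt0 b_even.
rewrite /upper_teeth !last_rcons !size_rcons /= -!cats1 !take_size_cat //.
rewrite rev_cat /= sumn_cat !fern_ups_cat (negPf a_even) /= fern_ups_cat oc /=.
rewrite cats0 addn0 add0n.
congr (_ :: _ ++ _ ++ fern_ups _ _ _); lia.
Qed.

Lemma fern_ups_lower :
  fern_ups true l (take (size a).-1 a ++ (last 0 a + g + head 0 c) :: behead c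
    ++ g' :: rev b ++ [:: r]) =
  lower_teeth l r g g' a c b.
Proof.
have [a' [am [-> oa]]] := rcons_of_even a_gt0 a_even.
case: c c_gt0 c_even => // c1 c' _ /=; rewrite negbK => oc.
rewrite /lower_teeth last_rcons size_rcons /= -cats1 take_size_cat //=.
rewrite sumn_cat !fern_ups_cat oa /= !fern_ups_cat oc /= !fern_ups_cat.
rewrite size_rev (negPf b_even) sumn_rev cats0 addn0 /=.
congr (_ ++ fern_ups _ _ _ ++ fern_ups _ _ _ ++ [:: (_, _)]); lia.
Qed.

Lemma semihex_upper :
  let U := bases (upper_teeth l g g' a c b) in
  semihex (l :: a ++ g :: take (size c).-1 c
    ++ (last 0 c + g' + last 0 b) :: rev (take (size b).-1 b))
  * hyperfact (size U) =
  vandermonde U.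
Proof. by rewrite /= -fern_ups_upper semihex_vandermonde. Qed.

Lemma semihex_lower :
  let D := bases (lower_teeth l r g g' a c b) in
  semihex (take (size a).-1 a ++ (last 0 a + g + head 0 c) :: behead c
    ++ g' :: rev b ++ [:: r]) * hyperfact (size D) =
  vandermonde D.
Proof. by rewrite /= -fern_ups_lower semihex_vandermonde. Qed.

End Teeth.

Section Rleft.

Variables (x y z : nat) (a c b : seq nat).
Hypothesis b_even : ~~ odd (size b).

Let nu := minn (sumn a) (sumn b).
Let l := y + sumn b - nu.
Let r := y + sumn a - nu.
Let g := (x + z)./2.
Let g' := uphalf (x + z).
Let w := sumn a + (x + z) + sumn c + sumn b.
Let q := z + osum a + esum b + esum c + r.

Let ferns u :=
  [|| in_fern false (l, q) a u, in_fern true (l + sumn a + g, q) c u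
    | in_fern false (l + sumn a + g + sumn c + g', q) (rev b) u].

Lemma in_Rleft (up : bool) (i j : nat) :
  ((up, (i, j)) \in Rleft x y z a c b) =
  [&& q + l <= i + j + (if up then 0 else 1),
      i + j + (if up then 1 else 2) <= q + l + w,
      i < q + l + (x + esum a + osum b + osum c)
    & j < q + l + (z + esum a + osum b + osum c)]
  && ~~ ferns (up, (i, j)).
Proof.
have [a_sum b_sum c_sum] := And3 (osumDesum a) (osumDesum b) (osumDesum c).
rewrite /Rleft in_filter_fset.
have -> : 2 * y + z + osum a + esum b + esum c
  + (maxn (sumn a) (sumn b) - minn (sumn a) (sumn b)) = q + l by lia.
have -> : z + osum a + esum b + esum c
  + (if sumn a <= sumn b then y else y + sumn a - sumn b) = q.
  by case: leqP; lia.
set s := x + esum a + osum b + osum c.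
have -> : minn (q + l + s) (q + l + s + (z + osum a + esum b + esum c) - q) =
  l + w by rewrite /s /w; lia.
rewrite in_rfernE ?b_even; last by rewrite /w; lia.
have -> : l + w - sumn b = l + sumn a + g + sumn c + g' by rewrite /w; lia.
by rewrite addKn in_hexagon; congr (_ && ~~ _); rewrite /s /w; case: up; lia.
Qed.

Lemma Rleft_glue :
  let ts1 := upper_teeth l g g' a c b in
  let ts2 := lower_teeth l r g g' a c b in
  Rleft x y z a c b =
  toothed_trapezoid 0 q (l + w) (size (bases ts1) + z) ts1
  `|` flip_cell q @` toothed_trapezoid l 0 (w + r) q ts2.
Proof.
have [a_sum b_sum c_sum] := And3 (osumDesum a) (osumDesum b) (osumDesum c).
move=> ts1 ts2; have ts1_size : size (bases ts1) = l + esum a + osum c + osum b.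
  exact: size_bases_upper_teeth.
apply: eq_glue.
- move=> [b0 [i j]]; rewrite in_toothed_trapezoid in_trapezoid.
  by case/andP=> /and3P[] /=; lia.
- move=> [b0 [i j]]; rewrite in_toothed_trapezoid in_trapezoid.
  by case/andP=> /and3P[] /=; lia.
- move=> [up [i j]] qj; rewrite in_Rleft [RHS]in_toothed_trapezoid /ferns.
  rewrite !in_fern_above // -!in_triangles_cat.
  have -> u : in_triangles q ts1 u =
    in_triangle true (0, q) l u || in_triangles q (behead ts1) u by [].
  rewrite [in RHS]negb_or [RHS]andbA in_trapezoid in_triangle_up ts1_size.
  by congr (_ && _); move: qj; rewrite /q /w; case: up => /=; lia.
- move=> [up [i k]] kq; rewrite [RHS]in_toothed_trapezoid.
  rewrite in_Rleft -[(~~ _, _)]/(flip_cell q (up, (i, k))) /ferns.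
  rewrite !in_fern_flip //.
  have -> u : in_triangles 0 ts2 u =
    [|| in_triangles 0 (fern_ups true l a) u,
        in_triangles 0 (fern_ups false (l + sumn a + g) c) u
      | in_triangles 0 (fern_ups true (l + sumn a + g + sumn c + g') (rev b)) u]
    || in_triangle true (l + sumn a + g + sumn c + g' + sumn b, 0) r u.
    by rewrite !in_triangles_cat [X in _ || (_ || (_ || X))]orbF !orbA.
  rewrite [in RHS]negb_or [RHS]andbA [RHS]andbAC in_trapezoid in_triangle_up.
  by congr (_ && _); move: kq; rewrite /q /w; case: up => /=; lia.
by move=> up i j jq; rewrite in_Rleft => /andP[/and4P[]]; lia.
Qed.

Lemma M_Rleft :
  let Y := maxn (sumn a) (sumn b) + y in
  let U := bases (upper_teeth l g g' a c b) in
  let D := bases (lower_teeth l r g g' a c b) in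
  M (Rleft x y z a c b) * (hyperfact (size U + z) * hyperfact (size D + z)) =
  vandermonde U * vandermonde D
  * gap_sum z (core_gaps Y g g' (sumn c)) (core_intervals Y g g' (sumn c)).
Proof.
move=> Y U D; have left_Y : l + sumn a = Y by rewrite /l /Y /nu; lia.
have right_Y : sumn b + r = Y by rewrite /r /Y /nu; lia.
have UD : perm_eq (U ++ D) (core_intervals Y g g' (sumn c)).
  by rewrite -left_Y; apply: perm_bases_teeth; rewrite left_Y right_Y.
have [a_sum b_sum c_sum] := And3 (osumDesum a) (osumDesum b) (osumDesum c).
have U_size : size U = l + esum a + osum c + osum b.
  exact: size_bases_upper_teeth.
have D_size : size D = osum a + esum c + esum b + r.
  exact: size_bases_lower_teeth.
have D_height : size D + z = q by rewrite D_size /q; lia.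
have := core_intervals_uniq Y g g' (sumn c); rewrite -(perm_uniq UD) cat_uniq.
case/and3P=> uU _ uD; rewrite -(eq_gap_sum _ _ UD) Rleft_glue -D_height.
apply: M_glue_toothed => //.
- by rewrite U_size /w; lia.
- by rewrite D_size /w; lia.
- by apply/allP=> p /mem_bases_upper_teeth; rewrite /w; lia.
- by apply/allP=> p /mem_bases_lower_teeth; rewrite /w; lia.
- exact: core_gaps_uniq.
by move=> i; rewrite (perm_mem UD) !mem_cat !mem_iota /w; lia.
Qed.

End Rleft.

Lemma cored_hexagon_Rleft x y z n : odd x != odd z ->
  cored_hexagon x (2 * y + z) z n = Rleft x y z [::] [:: n] [::].
Proof.
move=> hxz; apply/fsetP=> -[b [i j]].
rewrite [LHS]in_filter_fset [RHS]in_filter_fset.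
rewrite !(osum_cons, esum_cons, osum_nil, esum_nil) !in_hexagon /= !orbF.
have odd_x : odd x = ~~ odd z by case: (odd x) (odd z) hxz => [] [].
have -> : core_vertex x (2 * y + z) z = (y + (x + z)./2, z + y).
  rewrite /core_vertex oddD oddM /= odd_x eqxx andbT.
  case: (boolP (~~ odd z == odd z)); first by case: (odd z).
  move=> _; rewrite (_ : x + (2 * y + z) - 1 = (y + (x + z)./2).*2).
    by rewrite (_ : 2 * y + z + z = (z + y).*2) ?doubleK //; lia.
  have := odd_double_half (x + z); rewrite oddD odd_x.
  by case: (odd z) => /=; lia.
by congr (_ && _); [lia|congr (~~ in_triangle _ (_, _) _ _); lia].
Qed.

Lemma M_cored_hexagon x Y z n : odd x != odd z ->
  let g := (x + z)./2 in let g' := uphalf (x + z) in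
  M (cored_hexagon x (2 * Y + z) z n)
    * (hyperfact (Y + n + z) * hyperfact (Y + z))
    * (hyperfact (Y + g) * hyperfact (g + n)) =
  hyperfact Y * hyperfact n * (hyperfact (Y + g + n) * hyperfact g)
  * hyperfact Y
  * gap_sum z (core_gaps Y g g' n) (core_intervals Y g g' n).
Proof.
move=> hxz g g'; rewrite cored_hexagon_Rleft //.
have := @M_Rleft x Y z [::] [:: n] [::] isT; cbv zeta.
rewrite [sumn [::]]/= [sumn [:: n]]/= minnn maxnn !addn0 subn0 add0n -/g -/g'.
have -> : bases (upper_teeth Y g g' [::] [:: n] [::]) =
  iota 0 Y ++ iota (0 + Y + g) n.
  by rewrite /bases /= !addn0 cats0.
have -> : bases (lower_teeth Y Y g g' [::] [:: n] [::]) =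
  iota (Y + g + n + g') Y.
  by rewrite /bases /= !addn0 cats0.
rewrite size_cat !size_iota vandermonde_iota => ->.
by rewrite -(vandermonde_two_intervals 0); ring.
Qed.

Local Open Scope ring_scope.

Theorem theorem2p3 (x y z : nat) (a b c : seq nat)
  (hxz : odd x != odd z)
  (ha : (0 < size a)%N /\ ~~ odd (size a))
  (hb : (0 < size b)%N /\ ~~ odd (size b))
  (hc : (0 < size c)%N /\ ~~ odd (size c)) :
  let sa := sumn a in
  let sb := sumn b in
  let sc := sumn c in
  let g := ((x + z)./2)%N in
  let g' := uphalf (x + z)%N in
  let mu := maxn sa sb in
  let nu := minn sa sb in
  let H := fun n : nat => (hyperfact n)%:R : rat in
  (M (Rleft x y z a c b))%:R =
    (M (cored_hexagon x (2 * y + z + 2 * mu)%N z sc))%:R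
    * (semihex ((y + sb - nu)%N :: a ++ g :: take (size c).-1 c
                ++ (last 0%N c + g' + last 0%N b)%N :: rev (take (size b).-1 b)))%:R
    * (semihex (take (size a).-1 a ++ (last 0%N a + g + head 0%N c)%N :: behead c
                ++ g' :: rev b ++ [:: (y + sa - nu)%N]))%:R
    * (H (sc + g)%N / (H sc * H g))
    * (H (mu + y + g)%N / H (mu + sc + y + g)%N)
    * (H (mu + y + z)%N * H (mu + sc + y + z)%N
       / (H (mu - osum a + osum b + osum c + y + z)%N
          * H (mu + osum a - osum b + esum c + y + z)%N))
    * (H (mu - osum a + osum b + osum c + y)%N
       * H (mu + osum a - osum b + esum c + y)%N
       / H (mu + y)%N ^+ 2).
Proof.
move=> sa sb sc g g' mu nu H; have [[a0 ea] [b0 eb] [c0 ec]] := And3 ha hb hc.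
have := M_cored_hexagon (mu + y) sc hxz; have := M_Rleft x y z a c eb; cbv zeta.
rewrite -semihex_upper // -semihex_lower //.
rewrite size_bases_upper_teeth // size_bases_lower_teeth //.
rewrite -/sa -/sb -/sc -/g -/g' -/mu -/nu.
set F := gap_sum _ _ _; set A := semihex _; set B := semihex _ => eR eC.
have [oea oeb] := conj (osumDesum a) (osumDesum b).
have upper_size : (y + sb - nu + esum a + osum c + osum b)%N =
  (mu - osum a + osum b + osum c + y)%N by lia.
have lower_size : (osum a + esum c + esum b + (y + sa - nu))%N =
  (mu + osum a - osum b + esum c + y)%N by lia.
have H_neq0 n : H n != 0.
  by rewrite pnatr_eq0 -lt0n prodn_gt0 // => i; apply: fact_gt0.
rewrite upper_size lower_size in eR.
have -> : (2 * y + z + 2 * mu = 2 * (mu + y) + z)%N by lia.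
have -> : (mu + sc + y + z = mu + y + sc + z)%N by lia.
have -> : (mu + sc + y + g = mu + y + g + sc)%N by lia.
move: eR eC => /(congr1 (fun n => n%:R : rat)) eR.
move=> /(congr1 (fun n => n%:R : rat)).
rewrite [(sc + g)%N]addnC !natrM -!/(H _) in eR * => eC; rewrite -mulrA in eC.
rewrite (canRL (mulfK _) eR) ?mulf_neq0 // (canRL (mulfK _) eC) ?mulf_neq0 //.
by field; rewrite !H_neq0.
Qed.
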